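(* Let $G$ be a finite group, $N$ a normal subgroup of $G$, $J=J(F[N])$, and let $B$ be a $p$-block algebra of $F[G]$. Then $B$ covers a $p$-block of $N$ of defect zero if and only if the Cartan matrix of $B$ is equal to that of the image of $B$ in $F[G/N]$ or to that of the image of $B$ in $F[G]/F[G]J$.
   Context: $F$ is a field of characteristic $p>0$ that is a splitting field for the groups considered. $J(R)$ denotes the Jacobson radical of a ring $R$; $F[G]J$ is a two-sided ideal of $F[G]$. The images of $B$ are taken under the natural surjections $F[G]\to F[G/N]$ and $F[G]\to F[G]/F[G]J$. The Cartan matrix of an algebra has as its entries the multiplicities of the simple modules in the projective covers of the simple modules. The simple modules of an image of $B$ are among the simple modules of $B$, and Cartan matrices are compared with the indexing by simple modules (so equality includes having the same set of simple modules). *)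

(* Defs.v *)
From HB Require Import structures.
From mathcomp Require Import all_boot all_algebra all_fingroup all_field.
From mathcomp Require Import all_character.
From mathcomp Require Import classical_sets.

Set Implicit Arguments.
Unset Strict Implicit.
Unset Printing Implicit Defensive.

Import GRing.Theory.
Local Open Scope ring_scope.
Local Open Scope classical_set_scope.

Section GroupAlgebra.

Variables (F : fieldType) (gT : finGroupType).

(* The element \sum_g a_g g of F[gT] is the function g |-> a_g.  For a        *)
(* subgroup G of gT, F[G] is the subalgebra of functions supported in G.      *)
Definition galg := {ffun gT -> F^o}.
HB.instance Definition _ := Vector.on galg.

Implicit Types a b c : galg.

Definition gelt (x : gT) : galg := [ffun y => (y == x)%:R].

Definition gmul a b : galg := [ffun g => \sum_h a h * b (h^-1 * g)%g].

Fact gmulA : associative gmul.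
Proof.
move=> a b c; apply/ffunP=> g; rewrite !ffunE.
under [RHS]eq_bigr do rewrite ffunE mulr_suml.
rewrite exchange_big; apply: eq_bigr => h _; rewrite ffunE mulr_sumr.
rewrite [RHS](reindex_inj (mulgI h)); apply: eq_bigr => k _.
by rewrite mulrA mulKg invMg mulgA.
Qed.

Fact gmul1 : left_id (gelt 1) gmul.
Proof.
move=> a; apply/ffunP=> g; rewrite ffunE (bigD1 1%g) //= ffunE eqxx mul1r.
rewrite invg1 mul1g big1 ?addr0 // => h /negPf h1.
by rewrite ffunE h1 mul0r.
Qed.

Fact gmulr1 : right_id (gelt 1) gmul.
Proof.
move=> a; apply/ffunP=> g; rewrite ffunE (bigD1 g) //= ffunE mulVg eqxx mulr1.
rewrite big1 ?addr0 // => h /negPf hg.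
by rewrite ffunE -eq_mulVg1 hg mulr0.
Qed.

Fact gmulDl : left_distributive gmul +%R.
Proof.
move=> a b c; apply/ffunP=> g; rewrite !ffunE -big_split /=.
by apply: eq_bigr => h _; rewrite ffunE mulrDl.
Qed.

Fact gmulDr : right_distributive gmul +%R.
Proof.
move=> a b c; apply/ffunP=> g; rewrite !ffunE -big_split /=.
by apply: eq_bigr => h _; rewrite ffunE mulrDr.
Qed.

Fact gelt1_neq0 : gelt 1 != 0.
Proof.
by apply/eqP=> /ffunP/(_ 1%g)/eqP; rewrite !ffunE eqxx oner_eq0.
Qed.

HB.instance Definition _ := GRing.Zmodule_isNzRing.Build galg
  gmulA gmul1 gmulr1 gmulDl gmulDr gelt1_neq0.

Fact gscaleAl (k : F) a b : k *: (a * b) = (k *: a) * b.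
Proof.
apply/ffunP=> g; rewrite !ffunE /GRing.scale /= mulr_sumr.
by apply: eq_bigr => h _; rewrite ffunE mulrA.
Qed.

HB.instance Definition _ := GRing.Lmodule_isLalgebra.Build F galg gscaleAl.

Fact gscaleAr (k : F) a b : k *: (a * b) = a * (k *: b).
Proof.
apply/ffunP=> g; rewrite !ffunE /GRing.scale /= mulr_sumr.
by apply: eq_bigr => h _; rewrite ffunE /GRing.scale /= mulrCA.
Qed.

HB.instance Definition _ := GRing.Lalgebra_isAlgebra.Build F galg gscaleAr.
HB.instance Definition _ := Algebra_isFalgebra.Build F galg.

Definition group_alg (G : {set gT}) : set galg :=
  [set a | forall g, g \notin G -> a g = 0].

End GroupAlgebra.

Arguments group_alg F {gT} G.

(* The F-linear extension of a map of groups. *)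
Definition galg_map (F : fieldType) (gT rT : finGroupType) (f : gT -> rT)
  (a : galg F gT) : galg F rT := \sum_g a g *: gelt F (f g).

Section Ideals.

Variable E : nzRingType.
Implicit Types R L I X : set E.

Definition left_ideal R L :=
  [/\ L `<=` R, L 0, forall x y, L x -> L y -> L (x - y)
    & forall a x, R a -> L x -> L (a * x)].

Definition maximal_left_ideal R L :=
  [/\ left_ideal R L, L <> R &
      forall L', left_ideal R L' -> L `<=` L' -> L' = L \/ L' = R].

Definition jacobson R : set E :=
  [set x | R x /\ forall L, maximal_left_ideal R L -> L x].

Definition prod_set R X : set E :=
  [set z | exists n (a x : 'I_n -> E),
     [/\ forall i, R (a i), forall i, X (x i) & z = \sum_(i < n) a i * x i]].

End Ideals.

Section Blocks.

Variables (F : fieldType) (gT : finGroupType).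
Implicit Types (G D H : {group gT}) (e a : galg F gT).

Definition central_idem G e :=
  [/\ group_alg F G e, e * e = e & forall a, group_alg F G a -> a * e = e * a].

Definition block_idem G e :=
  [/\ central_idem G e, e != 0 &
      forall e1 e2, central_idem G e1 -> central_idem G e2 ->
        e1 * e2 = 0 -> e = e1 + e2 -> e1 = 0 \/ e2 = 0].

Definition block_alg G e : set (galg F gT) :=
  [set a * e | a in group_alg F G].

Definition block_covers e f := e * f != 0.

(* Tr_D^G, defined on the D-fixed points of F[G] for D a subgroup of G. *)
Definition rel_trace G D a : galg F gT :=
  \sum_(X in lcosets D G) gelt F (repr X) * a * gelt F (repr X)^-1%g.

Definition proj_rel_to G e D :=
  D \subset G /\
  exists a, [/\ group_alg F G a,
                forall d, d \in D -> gelt F d * a * gelt F d^-1%g = a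
              & rel_trace G D a = e].

Definition defect_group G e D :=
  proj_rel_to G e D /\
  forall H, H \subset D -> proj_rel_to G e H -> H = D.

Definition has_defect (p : nat) G e (d : nat) :=
  exists2 D, defect_group G e D & #|D| = (p ^ d)%N.

End Blocks.

(* A finite dimensional algebra is presented as a subquotient U / K of an     *)
(* ambient algebra E: U is a subspace of E closed under products, K is a      *)
(* two-sided ideal of U, and U / K has an identity, which need not be the     *)
(* class of 1 (as for a block algebra).                                       *)
Record subquot (F : fieldType) (E : falgType F) :=
  Subquot { sq_num : set E; sq_den : set E }.

Definition is_identity (F : fieldType) (E : falgType F) (A : subquot E) u :=
  sq_num A u /\ forall x, sq_num A x ->
    sq_den A (u * x - x) /\ sq_den A (x * u - x).

(* Finite dimensional unital left U / K-modules.  The action is given as a    *)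
(* linear map on E, but only its values on U are ever used.                   *)
Record amodule (F : fieldType) (E : falgType F) (A : subquot E) := AModule {
  carrier :> vectType F;
  act : 'Hom(E, 'End(carrier));
  _ : forall x y, sq_num A x -> sq_num A y ->
        act (x * y) = (act x \o act y)%VF;
  _ : forall x, sq_den A x -> act x = 0;
  _ : exists2 u, is_identity A u & act u = \1%VF }.

Section Modules.

Variables (F : fieldType) (E : falgType F) (A : subquot E).
Implicit Types M P Q S T : amodule A.

Definition submodule M (W : {vspace M}) :=
  forall x v, sq_num A x -> v \in W -> act M x v \in W.

Definition simple M :=
  fullv != 0%VS :> {vspace M} /\
  forall W : {vspace M}, submodule W -> W = 0%VS \/ W = fullv.

Definition is_hom P Q (f : 'Hom(P, Q)) :=
  forall x v, sq_num A x -> f (act P x v) = act Q x (f v).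

Definition projective P :=
  forall Q T (g : 'Hom(Q, T)) (f : 'Hom(P, T)),
    is_hom g -> limg g = fullv -> is_hom f ->
    exists2 h : 'Hom(P, Q), is_hom h & (g \o h)%VF = f.

Definition projective_cover P S (f : 'Hom(P, S)) :=
  [/\ projective P, is_hom f, limg f = fullv &
      forall W : {vspace P}, submodule W -> (W + lker f)%VS = fullv ->
        W = fullv].

(* W2 / W1 is isomorphic to T *)
Definition factor_iso M (W1 W2 : {vspace M}) T :=
  exists f : 'Hom(M, T),
    [/\ forall x v, sq_num A x -> v \in W2 -> f (act M x v) = act T x (f v),
        (f @: W2)%VS = fullv & (W2 :&: lker f)%VS = W1].

Definition composition_series M r (W : nat -> {vspace M}) :=
  [/\ W 0%N = 0%VS, W r = fullv, forall i, (i <= r)%N -> submodule (W i)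
    & forall i, (i < r)%N ->
        [/\ (W i <= W i.+1)%VS, W i <> W i.+1 &
            forall W' : {vspace M}, submodule W' ->
              (W i <= W')%VS -> (W' <= W i.+1)%VS ->
              W' = W i \/ W' = W i.+1]].

Definition multiplicity M T (m : nat) :=
  exists r (W : nat -> {vspace M}) (K : {set 'I_r}),
    [/\ composition_series r W,
        forall i, i \in K <-> factor_iso (W i) (W i.+1) T & #|K| = m].

(* m is the Cartan invariant of A at (S, T); by the existence and uniqueness  *)
(* of projective covers and by Jordan-Hoelder this determines m.              *)
Definition cartan S T (m : nat) :=
  exists P (f : 'Hom(P, S)), projective_cover f /\ multiplicity P T m.

End Modules.

Section CartanEq.

Variables (F : fieldType) (E E' : falgType F).
Variables (A : subquot E) (A' : subquot E') (phi : E -> E').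

(* When phi induces a surjective morphism from A to A': S is isomorphic to    *)
(* the A-module obtained from S' by inflation along phi.                      *)
Definition is_inflation (S : amodule A) (S' : amodule A') :=
  exists f : 'Hom(S, S'),
    [/\ lker f = 0%VS, limg f = fullv &
        forall x v, sq_num A x -> f (act S x v) = act S' (phi x) (f v)].

Definition same_cartan :=
  [/\ forall S : amodule A, simple S ->
        exists2 S' : amodule A', simple S' & is_inflation S S',
      forall S' : amodule A', simple S' ->
        exists2 S : amodule A, simple S & is_inflation S S'
    & forall (S T : amodule A) (S' T' : amodule A') (m : nat),
        simple S -> simple T -> simple S' -> simple T' ->
        is_inflation S S' -> is_inflation T T' ->
        (cartan S T m <-> cartan S' T' m)].

End CartanEq.

Section Images.

Variables (F : fieldType) (gT : finGroupType) (G N : {group gT}).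
Variable e : galg F gT.

Definition block_subquot := Subquot (block_alg G e) [set 0].

(* the image of F[G]e in F[G/N] *)
Definition block_image_quotient :=
  Subquot (galg_map (coset N) @` block_alg G e) [set 0].

(* F[G]J, where J = J(F[N]) *)
Definition rad_ideal : set (galg F gT) :=
  prod_set (group_alg F G) (jacobson (group_alg F N)).

(* the image of F[G]e in F[G] / F[G]J *)
Definition block_image_mod_rad :=
  Subquot [set x + y | x in block_alg G e & y in rad_ideal] rad_ideal.

End Images.

(* Main.v *)
(* Let A = F[G]e and let A -> A' be one of the two surjections.  If the Cartan
   matrices agree, then A -> A' is injective: a nonzero kernel would make the
   projective cover over A' of some simple module a proper quotient of its
   projective cover over A, losing a composition factor.
     For A' in F[G]/F[G]J, injectivity means Je = 0.  If f is a block of N with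
   ef <> 0, this produces a primitive idempotent i of F[N]f with iJ = 0, so that
   i F[N] is simple and, F being a splitting field, i F[N] i = Fi.  The symmetric
   form of F[N] then gives i Tr_1^N(i) i = i(1)^-1 i, hence the central element
   Tr_1^N(i) f is a unit of the local ring Z(F[N]f) and f is in the image of
   Tr_1^N, i.e., f has defect zero.
     For A' in F[G/N], injectivity means that N acts trivially on A, which forces
   |N| <> 0 in F; then all blocks of N have defect zero.
     Conversely, if f = Tr_1^N(a), then Jf = 0 by averaging a linear projection
   onto the left ideal generated by an element of Jf.  The same holds for the
   conjugates of f, whence Je = 0 and A -> A' is an isomorphism for A' in
   F[G]/F[G]J. *)
Require Import Defs.
From HB Require Import structures.
From mathcomp Require Import all_boot all_algebra all_fingroup all_field.
From mathcomp Require Import all_character.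
From mathcomp Require Import classical_sets boolp.
Import Defs.

Set Implicit Arguments.
Unset Strict Implicit.
Unset Printing Implicit Defensive.

Import GRing.Theory.
Local Open Scope ring_scope.

(** * Idempotents in finite-dimensional algebras *)

Lemma exists_minimal (T : Type) (P : T -> Prop) (m : T -> nat) :
  (exists x, P x) -> exists2 x, P x & forall y, P y -> (m x <= m y)%N.
Proof.
case=> x Px; have [k] := ubnP (m x); elim: k => // k IH in x Px *.
move=> mx; have [[y [Py myx]]|nex] := EM (exists y, P y /\ (m y < m x)%N).
  by apply: (IH y) => //; apply: leq_trans myx _; rewrite -ltnS.
exists x => // y Py; rewrite leqNgt; apply/negP=> myx; apply: nex.
by exists y.
Qed.

Lemma exists_maximal_vspace (F : fieldType) (V : vectType F)
    (P : {vspace V} -> Prop) :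
  (exists W, P W) ->
  exists2 W, P W & forall W', P W' -> (W <= W')%VS -> W' = W.
Proof.
move=> exP; have [W PW maxW] := exists_minimal (fun W => dim V - \dim W)%N exP.
exists W => // W' PW' WW'; apply/esym/eqP; rewrite eqEdim WW' /=.
by have := maxW W' PW'; rewrite leq_sub2lE // -dimvf dimvS ?subvf.
Qed.

Section Idempotents.

Variables (F : fieldType) (E : falgType F).
Implicit Types (U V : {vspace E}) (x y z i : E).

Definition mulv_closed U := {in U &, forall x y, x * y \in U}.

Lemma annihilating_poly x : exists2 p : {poly F}, p != 0 & horner_alg x p = 0.
Proof.
apply: contrapT => npx; pose d := \dim {:E}.
pose X := [tuple x ^+ i | i < d.+1]; have XE (i : 'I_d.+1) : X`_i = x ^+ i.
  by rewrite -tnth_nth tnth_mktuple.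
have : free X.
  apply/freeP=> k kX; pose p := \poly_(i < d.+1) k (inord i).
  have p0 : p = 0.
    apply: contrapT => /eqP p0; apply: npx; exists p => //.
    rewrite /p poly_def rmorph_sum /= -[RHS]kX; apply: eq_bigr => i _.
    rewrite inord_val -mul_polyC rmorphM rmorphXn /= horner_algC horner_algX.
    by rewrite mulr_algl XE.
  move=> i; have := coef_poly d.+1 (k \o inord) i.
  by rewrite ltn_ord /= inord_val -/p p0 coef0 => <-.
rewrite /free size_tuple => /eqP Ed.
by have := dimvS (subvf <<X>>); rewrite Ed ltnn.
Qed.

(* Fitting's lemma: [x * y] is the idempotent cutting out the part where [x]
   acts invertibly. *)
Lemma fitting U x : mulv_closed U -> x \in U ->
  exists y n, [/\ y \in U, x * y = y * x, (x * y) * (x * y) = x * y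
                & x ^+ n * (x * y) = x ^+ n].
Proof.
move=> UM Ux; have [p p0 px'] := annihilating_poly x.
have [h [hX hK px]] : exists h : {rmorphism {poly F} -> E},
    [/\ h 'X = x, forall c, h c%:P = c%:A & h p = 0].
  exists (horner_alg x); split=> [|c|]; last exact: px'.
    exact: horner_algX.
  exact: horner_algC.
have [m [q q0 Dp]] := multiplicity_XsubC p 0.
(* Now [p = q * 'X^m] with [q] prime to ['X]. The exponent [m.+2] leaves a factor [x] in
   [y := x ^+ m.+1 * h u]: as [U] need not contain 1, only multiples of [x] are known to lie in
   it. *)
rewrite p0 subr0 /= in q0 Dp; pose n := m.+2.
have cop : coprimep 'X^n q.
  by rewrite coprimep_pexpl // coprimep_sym -['X]subr0 -polyC0 coprimep_XsubC.
have [[u v] /= uv1] := Bezout_eq1_coprimepP _ _ cop.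
have hq : h (q * 'X^n) = 0.
  by rewrite /n -addn2 exprD mulrA -Dp rmorphM /= px mul0r.
have xn : h u * (x ^+ n * x ^+ n) = x ^+ n.
  rewrite -[RHS]mul1r -(rmorph1 h) -uv1 rmorphD mulrDl -hX -!rmorphXn.
  by rewrite -!rmorphM /= -[v * q * _]mulrA [h (v * _)]rmorphM hq mulr0 addr0 mulrA.
have hC r s : h r * h s = h s * h r by rewrite -!rmorphM mulrC.
have xnC k r : x ^+ k * h r = h r * x ^+ k by rewrite -hX -rmorphXn hC.
exists (x ^+ m.+1 * h u), n; have E1 : x * (x ^+ m.+1 * h u) = h u * x ^+ n.
  by rewrite mulrA -exprS xnC.
split.
- have UX r : x * h r \in U.
    elim/poly_ind: r => [|r c IH]; first by rewrite rmorph0 mulr0 mem0v.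
    rewrite rmorphD mulrDr rmorphM /= hX mulrA hK.
    by rewrite mulr_algr; apply: memvD; [apply: UM | apply: memvZ].
  by rewrite exprS -mulrA -{2}hX -rmorphXn -rmorphM UX.
- by rewrite E1 xnC -mulrA -exprSr.
- by rewrite E1 -mulrA (mulrA (x ^+ n)) xnC -(mulrA (h u)) xn.
by rewrite E1 mulrA xnC -mulrA xn.
Qed.

Definition primitive_idem U i :=
  [/\ i \in U, i * i = i, i != 0 & forall j, j \in U -> j * j = j ->
      i * j = j -> j * i = j -> j = 0 \/ j = i].

(** The corner [i U i] is local: Fitting's idempotent [x * y] lies in it, so primitivity makes it 0
    or [i], and [x] is nilpotent or invertible accordingly. *)
Lemma primitive_local U i x : mulv_closed U -> primitive_idem U i ->
  x \in U -> i * x = x -> x * i = x ->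
  (exists n, x ^+ n = 0) \/
  (exists y, [/\ y \in U, y * x = i & x * y = i]).
Proof.
move=> UM [Ui ii i0 prim] Ux ix xi; have [y [n [Uy xy xyxy xn]]] := fitting UM Ux.
case: (prim (x * y)); rewrite ?UM //.
- by rewrite mulrA ix.
- by rewrite xy -mulrA xi.
- by move=> xy0; left; exists n; rewrite -xn xy0 mulr0.
move=> xyi; right; exists (i * y * i).
have E1 : i * y * i * x = i by rewrite -mulrA ix -mulrA -xy xyi ii.
have E2 : x * (i * y * i) = i by rewrite !mulrA xi xyi ii.
by split; rewrite ?UM.
Qed.

(* Take [i] of minimal rank among the idempotents with [Q i]. *)
Lemma exists_primitive_idem U (Q : E -> Prop) j :
  j \in U -> j * j = j -> Q j -> ~ Q 0 ->
  (forall x y, Q (x + y) -> Q x \/ Q y) ->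
  exists2 i, primitive_idem U i & Q i.
Proof.
move=> Uj jj Qj Q0 Qadd.
pose P i := [/\ i \in U, i * i = i & Q i].
pose m i := \dim (limg (amulr i)).
have [i [Ui ii Qi] min] : exists2 i, P i & forall y, P y -> (m i <= m y)%N.
  by apply: exists_minimal; exists j.
have minimal k : k \in U -> k * k = k -> i * k = k -> k * i = k -> Q k -> k = i.
  move=> Uk kk ik ki Qk.
  have /eqP Eki : limg (amulr k) == limg (amulr i).
    rewrite eqEdim min // andbT; apply/subvP=> _ /memv_imgP[x _ ->].
    rewrite lfunE /= -ki mulrA.
    by apply/memv_imgP; exists (x * k); rewrite ?memvf // lfunE.
  have : i \in limg (amulr i) by apply/memv_imgP; exists i; rewrite ?memvf // lfunE.
  by rewrite -Eki => /memv_imgP[x _]; rewrite lfunE /= => Dx; rewrite -ik Dx -mulrA kk.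
exists i => //; split=> //; first by apply/eqP=> i0; apply: Q0; rewrite -i0.
move=> k Uk kk ik ki; have [|Qk|Qk] := Qadd k (i - k).
- by rewrite addrC subrK.
- by right; apply: minimal.
left; have : i - k = i.
  apply: minimal; rewrite ?memvB //.
  - by rewrite mulrBl !mulrBr ii ik ki kk subrr subr0.
  - by rewrite mulrBr ii ik.
  - by rewrite mulrBl ii ki.
by move/eqP; rewrite subr_eq addrC -subr_eq subrr => /eqP.
Qed.

Lemma exprMM x y n : (x * y) ^+ n.+1 = x * (y * x) ^+ n * y.
Proof.
elim: n => [|n IH]; first by rewrite expr1 mulr1.
by rewrite exprS IH [in RHS]exprS !mulrA.
Qed.

Lemma nilpotent_swap x y :
  (exists n, (x * y) ^+ n = 0) -> exists n, (y * x) ^+ n = 0.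
Proof. by move=> [n xyn]; exists n.+1; rewrite exprMM xyn mulr0 mul0r. Qed.

End Idempotents.

(** * Modules over subquotients *)

Section ModuleBasics.

Variables (F : fieldType) (E : falgType F) (A : subquot E).
Implicit Types (M P Q S T : amodule A) (x y : E).

Lemma actM M x y v : sq_num A x -> sq_num A y ->
  act M (x * y) v = act M x (act M y v).
Proof. by case: M v => V a aM aD aI v Ax Ay /=; rewrite aM // comp_lfunE. Qed.

Lemma act_den M x : sq_den A x -> act M x = 0.
Proof. by case: M => V a aM aD aI /=; apply: aD. Qed.

(** A module only records that some identity [w] acts as 1. Since [u * w] and [w] agree modulo
    [sq_den A], so does every other identity [u]. *)
Lemma act_identity M u : is_identity A u -> act M u = \1%VF.
Proof.
move=> [Au uP]; have [w [Aw wP] w1] : exists2 w, is_identity A w & act M w = \1%VF.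
  by case: M => V a aM aD aI /=; apply: aI.
apply/lfunP=> v; have := act_den M (uP w Aw).1.
by rewrite linearB /= => /subr0_eq/lfunP/(_ v); rewrite actM // w1 id_lfunE.
Qed.

Lemma submodule0 M : submodule (0%VS : {vspace M}).
Proof. by move=> x v _; rewrite !memv0 => /eqP->; rewrite linear0. Qed.

Lemma submodulef M : submodule (fullv : {vspace M}).
Proof. by move=> x v _ _; rewrite memvf. Qed.

Lemma submoduleD M (V W : {vspace M}) :
  submodule V -> submodule W -> submodule (V + W)%VS.
Proof.
move=> hV hW x _ Ax /memv_addP[v Vv [w Ww ->]].
by rewrite linearD memv_add ?hV ?hW.
Qed.

Lemma submodule_img P Q (f : 'Hom(P, Q)) (V : {vspace P}) :
  is_hom f -> submodule V -> submodule (f @: V)%VS.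
Proof.
move=> hf hV x _ Ax /memv_imgP[v Vv ->].
by rewrite -hf // memv_img // hV.
Qed.

Lemma submodule_preim P Q (f : 'Hom(P, Q)) (W : {vspace Q}) :
  is_hom f -> submodule W -> submodule (f @^-1: W)%VS.
Proof. by move=> hf hW x v Ax; rewrite -!memv_preim hf //; apply: hW. Qed.

Lemma submodule_ker P Q (f : 'Hom(P, Q)) : is_hom f -> submodule (lker f).
Proof.
by move=> hf; rewrite -lpreim0; apply: submodule_preim; last exact: submodule0.
Qed.

Lemma exists_composition_series M : exists r W, composition_series (M := M) r W.
Proof.
suff H (V : {vspace M}) : submodule V -> exists r (W : nat -> {vspace M}),
    [/\ W 0%N = 0%VS, W r = V, forall i, (i <= r)%N -> submodule (W i)
    & forall i, (i < r)%N ->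
        [/\ (W i <= W i.+1)%VS, W i <> W i.+1 &
            forall W' : {vspace M}, submodule W' ->
              (W i <= W')%VS -> (W' <= W i.+1)%VS ->
              W' = W i \/ W' = W i.+1]].
  by apply: H (@submodulef M).
have [k] := ubnP (\dim V); elim: k => // k IH in V *; rewrite ltnS => dV hV.
have [V0|V0] := eqVneq V 0%VS.
  by exists 0%N, (fun=> 0%VS); split=> // i _; apply: submodule0.
pose maximal_cand (V1 : {vspace M}) := [/\ submodule V1, (V1 <= V)%VS & V1 <> V].
have [V1 [hV1 sV1 nV1] maxV1] : exists2 V1, maximal_cand V1 &
    forall V2, maximal_cand V2 -> (V1 <= V2)%VS -> V2 = V1.
  apply: exists_maximal_vspace; exists 0%VS; split; [exact: submodule0 | exact: sub0v |].
  by move/esym/eqP; rewrite (negPf V0).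
have dV1 : (\dim V1 < \dim V)%N.
  rewrite ltn_neqAle dimvS // andbT; apply/eqP=> dd; apply: nV1.
  by apply/eqP; rewrite eqEdim sV1 dd leqnn.
have [r [W [W0 Wr sW cW]]] := IH V1 (leq_trans dV1 dV) hV1.
exists r.+1, (fun i => if (i <= r)%N then W i else V); split=> //.
- by rewrite ltnn.
- by move=> i _; case: ifP => [/sW|].
move=> i; rewrite ltnS => ir; rewrite ir.
have [lt_ir|le_ri] := ltnP i r; first exact: cW.
have -> : i = r by apply/eqP; rewrite eqn_leq ir.
rewrite Wr; split=> // W' sW' V1W' W'V; have [->|nW'] := EM (W' = V); first by right.
by left; apply: maxV1.
Qed.

Lemma exists_multiplicity M T : exists m, multiplicity M T m.
Proof.
have [r [W cW]] := exists_composition_series M.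
exists #|[set i : 'I_r | `[< factor_iso (W i) (W i.+1) T >]]|, r, W.
exists [set i : 'I_r | `[< factor_iso (W i) (W i.+1) T >]]; split=> // i.
by rewrite inE; split=> /asboolP.
Qed.

End ModuleBasics.

(** * Restriction of modules along a morphism of subquotients *)

Section Pullback.

Variables (F : fieldType) (E E' : falgType F) (A : subquot E) (A' : subquot E').

(** A linear map of the ambient algebras rather than a ring morphism: it is multiplicative only
    modulo [sq_den A'], and it respects an identity of [A] that need not be the ambient 1. *)
Definition subquot_morph (phi : 'Hom(E, E')) :=
  [/\ forall x, sq_num A x -> sq_num A' (phi x),
      forall x y, sq_num A x -> sq_num A y ->
        sq_den A' (phi (x * y) - phi x * phi y),
      forall x, sq_den A x -> sq_den A' (phi x)
    & exists2 u, is_identity A u & is_identity A' (phi u)].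

Variables (phi : 'Hom(E, E')) (hphi : subquot_morph phi).

Fact pull_actM (M : amodule A') x y : sq_num A x -> sq_num A y ->
  (act M \o phi)%VF (x * y) = ((act M \o phi)%VF x \o (act M \o phi)%VF y)%VF.
Proof.
move=> Ax Ay; have [hN hM _ _] := hphi; rewrite !comp_lfunE.
have /eqP := act_den M (hM x y Ax Ay); rewrite linearB subr_eq0 => /eqP ->.
by apply/lfunP=> v; rewrite comp_lfunE actM //; apply: hN.
Qed.

Fact pull_act_den (M : amodule A') x : sq_den A x -> (act M \o phi)%VF x = 0.
Proof.
by move=> Ax; have [_ _ hD _] := hphi; rewrite comp_lfunE act_den //; apply: hD.
Qed.

Fact pull_act_id (M : amodule A') :
  exists2 u, is_identity A u & (act M \o phi)%VF u = \1%VF.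
Proof.
have [_ _ _ [u uA uA']] := hphi; exists u => //.
by rewrite comp_lfunE act_identity.
Qed.

Definition pull (M : amodule A') : amodule A :=
  AModule (@pull_actM M) (@pull_act_den M) (pull_act_id M).

Lemma pullE (M : amodule A') x : act (pull M) x = act M (phi x).
Proof. exact: comp_lfunE. Qed.

Hypothesis surj : forall y, sq_num A' y ->
  exists2 x, sq_num A x & sq_den A' (y - phi x).

(** Surjectivity makes [A] and [A'] act on [M] through the same operators, which is why submodules,
    simplicity and composition series are unchanged by [pull]. *)
Lemma act_surj (M : amodule A') y : sq_num A' y ->
  exists2 x, sq_num A x & act M y = act (pull M) x.
Proof.
case/surj=> x Ax /(act_den M)/eqP; rewrite linearB subr_eq0 => /eqP ->.
by exists x => //; rewrite pullE.
Qed.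

Let Aphi x : sq_num A x -> sq_num A' (phi x).
Proof. by case: hphi => hN _ _ _; apply: hN. Qed.

Lemma submodule_pull (M : amodule A') (W : {vspace M}) :
  submodule (M := pull M) W <-> submodule W.
Proof.
split=> hW x v Ax; last by rewrite pullE; apply: hW; apply: Aphi.
by have [y Ay ->] := act_surj M Ax; apply: hW.
Qed.

Lemma is_hom_pull (P Q : amodule A') (f : 'Hom(P, Q)) :
  is_hom (P := pull P) (Q := pull Q) f <-> is_hom f.
Proof.
split=> hf x v Ax; last by rewrite !pullE; apply: hf; apply: Aphi.
have [y Ay] := surj Ax; move=> /[dup] /(act_den P)/eqP.
rewrite linearB subr_eq0 => /eqP -> /(act_den Q)/eqP.
by rewrite linearB subr_eq0 => /eqP ->; have := hf y v Ay; rewrite !pullE.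
Qed.

Lemma simple_pull (M : amodule A') : simple (pull M) <-> simple M.
Proof.
by split=> -[M0 hM]; split=> // W /submodule_pull hW; apply: hM.
Qed.

Lemma composition_series_pull (M : amodule A') r (W : nat -> {vspace M}) :
  composition_series (M := pull M) r W <-> composition_series r W.
Proof.
split=> -[W0 Wr sW cW]; split=> //.
- by move=> i /sW/submodule_pull.
- by move=> i /cW[W1 W2 W3]; split=> // W' /submodule_pull; apply: W3.
- by move=> i /sW/submodule_pull.
by move=> i /cW[W1 W2 W3]; split=> // W' /submodule_pull; apply: W3.
Qed.

Lemma factor_iso_pull (M : amodule A') (W1 W2 : {vspace M})
    (T : amodule A) (T' : amodule A') :
  is_inflation phi T T' ->
  factor_iso (M := pull M) W1 W2 T <-> factor_iso W1 W2 T'.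
Proof.
move=> [i [/eqP i0 i1 hi]]; split=> -[f [hf fW2 kf]].
  exists (i \o f)%VF; split.
  - move=> y v Ay Wv; have [x Ax] := surj Ay; move=> /[dup] /(act_den M)/eqP.
    rewrite linearB subr_eq0 => /eqP -> /(act_den T')/eqP.
    rewrite linearB subr_eq0 => /eqP ->; have := hf x v Ax Wv.
    by rewrite pullE !comp_lfunE => ->; rewrite hi.
  - by rewrite limg_comp fW2.
  - rewrite -kf; congr (_ :&: _)%VS; apply/vspaceP=> v.
    by rewrite !memv_ker comp_lfunE -memv_ker (eqP i0) memv0.
have iK w : i ((i^-1)%VF w) = w by rewrite limg_lfunVK // i1 memvf.
exists (i^-1 \o f)%VF; split.
- move=> x v Ax Wv; rewrite pullE !comp_lfunE hf //; last exact: Aphi.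
  by apply: (lker0P i0); rewrite hi // !iK.
- rewrite limg_comp fW2; apply/vspaceP=> v; rewrite memvf.
  by apply/memv_imgP; exists (i v); rewrite ?memvf // lker0_lfunK.
rewrite -kf; congr (_ :&: _)%VS; apply/vspaceP=> v.
rewrite !memv_ker comp_lfunE; apply/eqP/eqP=> [|->]; last by rewrite linear0.
have /memv_imgP[w _ ->] : f v \in limg i by rewrite i1 memvf.
by rewrite lker0_lfunK // => ->; rewrite linear0.
Qed.

Lemma multiplicity_pull (M T' : amodule A') (T : amodule A) m :
  is_inflation phi T T' ->
  multiplicity (pull M) T m <-> multiplicity M T' m.
Proof.
move=> hT; split=> -[r [W [K [cW hK <-]]]]; exists r, W, K; split=> //.
- exact/composition_series_pull.
- by move=> i; split=> [/hK|] h; [|apply/hK]; apply/(factor_iso_pull _ _ hT).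
- exact/composition_series_pull.
by move=> i; split=> [/hK|] h; [|apply/hK]; apply/(factor_iso_pull _ _ hT).
Qed.

End Pullback.

(** * Quotient modules, and left ideals cut out by idempotents *)

Section ModuleConstructions.

Variables (F : fieldType) (E : falgType F).

Definition conj_act (V W : vectType F) (a : 'Hom(E, 'End(V)))
  (f : 'Hom(V, W)) (g : 'Hom(W, V)) (x : E) : 'End(W) := (f \o (a x \o g))%VF.

Fact conj_act_is_linear V W a f g : linear (@conj_act V W a f g).
Proof.
move=> k x y; apply/lfunP=> v; rewrite add_lfunE scale_lfunE !comp_lfunE.
by rewrite linearP add_lfunE scale_lfunE linearP.
Qed.

HB.instance Definition _ (V W : vectType F) a f g := GRing.isLinear.Build F E _ _
  (@conj_act V W a f g) (@conj_act_is_linear V W a f g).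

Lemma conj_actE (V W : vectType F) a f g x v :
  linfun (@conj_act V W a f g) x v = f (a x (g v)).
Proof. by rewrite lfunE /= !comp_lfunE. Qed.

Definition lfun_at (V W : vectType F) (v : V) (f : 'Hom(V, W)) := f v.

Fact lfun_at_is_linear V W v : linear (@lfun_at V W v).
Proof. by move=> k f g; rewrite /lfun_at add_lfunE scale_lfunE. Qed.

HB.instance Definition _ (V W : vectType F) v := GRing.isLinear.Build F _ W _
  (@lfun_at V W v) (@lfun_at_is_linear V W v).

Variable A : subquot E.

(** The quotient lives on the complement [W^C], where [s] is a mere linear section of [q]; stability
    of [W] makes [q] commute with the transported action ([aq]). *)
Lemma quotient_module (M : amodule A) (W : {vspace M}) : submodule W ->
  exists (Q : amodule A) (q : 'Hom(M, Q)),
    [/\ is_hom q, limg q = fullv & lker q = W].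
Proof.
move=> hW.
pose q : 'Hom(M, subvs_of (W^C)%VS) := (linfun (vsproj W^C) \o (\1 - projv W))%VF.
pose s : 'Hom(subvs_of (W^C)%VS, M) := linfun vsval.
have qE v : vsval (q v) = v - projv W v.
  by rewrite comp_lfunE lfunE /= vsprojK add_lfunE opp_lfunE id_lfunE ?memv_projC.
have qs v : q (s v) = v.
  apply: val_inj; rewrite /= qE lfunE /=.
  suff -> : projv W (vsval v) = 0 by rewrite subr0.
  apply/eqP; rewrite -memv_ker lker_proj; exact: subvsP.
have kq v : (v \in lker q) = (v \in W).
  rewrite memv_ker; apply/eqP/idP=> [qv|Wv].
    have := qE v; rewrite qv /= => /esym/subr0_eq ->; exact: memv_proj.
  by apply: val_inj; rewrite /= qE projv_id // subrr.
pose a : 'Hom(E, 'End(subvs_of (W^C)%VS)) := linfun (conj_act (act M) q s).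
have aE x v : a x v = q (act M x (s v)) by rewrite conj_actE.
have aq x v : sq_num A x -> a x (q v) = q (act M x v).
  move=> Ax; rewrite aE; apply/eqP; rewrite -subr_eq0 -linearB -linearB /=.
  rewrite -memv_ker kq; apply: hW => //.
  by rewrite -kq memv_ker linearB /= qs subrr.
have aM x y : sq_num A x -> sq_num A y -> a (x * y) = (a x \o a y)%VF.
  move=> Ax Ay; apply/lfunP=> v.
  by rewrite comp_lfunE [a y v]aE aq // aE actM.
have aD x : sq_den A x -> a x = 0.
  move=> Ax; apply/lfunP=> v.
  by rewrite aE act_den // zero_lfunE linear0 zero_lfunE.
have aI : exists2 u, is_identity A u & a u = \1%VF.
  have [u uA] : exists u, is_identity A u by case: (M) => V b _ _ [u uA _]; exists u.
  exists u => //; apply/lfunP=> v.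
  by rewrite aE (act_identity M uA) !id_lfunE qs.
exists (AModule aM aD aI), q; split.
- by move=> x v Ax; rewrite -aq.
- by apply/vspaceP=> v; rewrite memvf -(qs v) memv_img ?memvf.
exact/vspaceP.
Qed.

Variable U : {vspace E}.
Hypotheses (numU : forall x, sq_num A x <-> x \in U).
Hypotheses (den0 : forall x, sq_den A x <-> x = 0) (UM : mulv_closed U).

Lemma left_ideal_module u i : is_identity A u -> i \in U -> i * i = i ->
  exists (P : amodule A) (j : 'Hom(P, E)),
    [/\ lker j = 0%VS, forall x, x \in limg j <-> x \in U /\ x * i = x
      & forall x v, sq_num A x -> j (act P x v) = x * j v].
Proof.
move=> [Uu uP] Ui ii; pose V := (amulr i @: U)%VS.
have VP x : x \in V <-> x \in U /\ x * i = x.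
  split=> [/memv_imgP[y Uy ->]|[Ux xi]].
    by rewrite lfunE /= -mulrA ii; split=> //; apply: UM.
  by apply/memv_imgP; exists x => //; rewrite lfunE.
pose j : 'Hom(subvs_of V, E) := linfun vsval.
pose a := linfun (conj_act (linfun (@amull F E)) (linfun (vsproj V)) j).
have jE v : j v = vsval v by rewrite lfunE.
have ja x v : sq_num A x -> j (a x v) = x * j v.
  move/numU=> Ux; rewrite conj_actE !jE.
  have -> w : linfun (vsproj V) w = vsproj V w by exact: lfunE.
  rewrite (_ : linfun _ x = amull x); last exact: lfunE.
  rewrite lfunE /= vsprojK //.
  have /VP[Uv vi] := subvsP v; apply/VP; rewrite -mulrA vi; split=> //.
  exact: UM.
have j0 : lker j == 0%VS by apply/lker0P=> v w; rewrite !jE; apply: val_inj.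
have aM x y : sq_num A x -> sq_num A y -> a (x * y) = (a x \o a y)%VF.
  move=> Ax Ay; apply/lfunP=> v; apply: (lker0P j0).
  rewrite comp_lfunE !ja ?mulrA //; apply/numU; apply: UM; exact/numU.
have aD x : sq_den A x -> a x = 0 by move/den0 ->; rewrite linear0.
have aI : exists2 w, is_identity A w & a w = \1%VF.
  exists u => //; apply/lfunP=> v; apply: (lker0P j0); rewrite ja // id_lfunE.
  have /VP[Uv _] := subvsP v; rewrite jE.
  by have /numU/uP[/den0/subr0_eq] := Uv.
exists (AModule aM aD aI), j; split=> //; first exact/eqP.
move=> x; rewrite -VP; split=> [/memv_imgP[v _ ->]|Vx]; first by rewrite jE subvsP.
by apply/memv_imgP; exists (vsproj V x); rewrite ?memvf // jE vsprojK.
Qed.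

End ModuleConstructions.

(** * Projective indecomposable modules *)

Lemma nilpotent_unit (R : nzRingType) (x : R) n : x ^+ n = 0 ->
  exists c, (1 - x) * c = 1.
Proof.
move=> xn; exists (\sum_(i < n) x ^+ i).
by rewrite -opprB mulNr -subrX1 xn sub0r opprK.
Qed.

(** Used to see that [i] is not a sum of two nilpotents of its corner: [i - x = i * (1 - x)] with
    [1 - x] right invertible, so a vanishing power of [i - x] forces [i = 0]. *)
Lemma nilpotent_complement (R : nzRingType) (i x : R) n m :
  i * i = i -> i * x = x -> x * i = x -> x ^+ n = 0 -> (i - x) ^+ m = 0 -> i = 0.
Proof.
move=> ii ix xi xn; have [c c1] := nilpotent_unit xn.
case: m => [/eqP|m]; first by rewrite expr0 oner_eq0.
have -> : i - x = i * (1 - x) by rewrite mulrBr ix mulr1.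
rewrite exprMn_comm; last by rewrite /GRing.comm mulrBr mulrBl ix xi mulr1 mul1r.
have iX k : i ^+ k.+1 = i.
  by elim: k => [|k IH]; rewrite ?expr1 // exprS IH ii.
rewrite iX => e0.
have cX k : (1 - x) ^+ k * c ^+ k = 1.
  elim: k => [|k IH]; first by rewrite mulr1.
  by rewrite exprSr exprS mulrA -(mulrA _ _ c) c1 mulr1.
by rewrite -[i]mulr1 -(cX m.+1) mulrA e0 mul0r.
Qed.

Section ProjectiveIndecomposables.

Variables (F : fieldType) (E : falgType F) (A : subquot E) (U : {vspace E}).
Hypotheses (numU : forall x, sq_num A x <-> x \in U).
Hypotheses (den0 : forall x, sq_den A x <-> x = 0) (UM : mulv_closed U).
Variable u : E.
Hypothesis uA : is_identity A u.
Implicit Types (M P S : amodule A).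

(* [P] is the left ideal [U * i] with generator [p] corresponding to [i], and
   [q] is the projection onto its head. *)
Definition pim_head i P (p : P) S (q : 'Hom(P, S)) :=
  [/\ forall v, exists2 x, x \in U & v = act P x p,
      forall x, x \in U -> act P x p = 0 -> x * i = 0,
      act P i p = p,
      forall M w, act M i w = w -> exists2 h : 'Hom(P, M), is_hom h & h p = w
    & [/\ is_hom q, limg q = fullv, q p != 0
        & forall W, submodule W -> p \notin W -> (W <= lker q)%VS]].

(** [P] is [U * i] and [p] is [i]. As [i U i] is local, elements of proper submodules have nilpotent
    components in the corner, so two proper submodules never sum to [P]. Hence there is a largest
    one, and [S] is the quotient by it. *)
Lemma exists_pim_head i : primitive_idem U i ->
  exists P p S q, @pim_head i P p S q.
Proof.
move=> pi; have [Ui ii i0 _] := pi.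
have [P [j [/eqP j0 jV jact]]] := left_ideal_module numU den0 UM uA Ui ii.
have jinj := lker0P j0.
have /memv_imgP[p _ jp] : i \in limg j by apply/jV.
have jP v : j v \in U /\ j v * i = j v by apply/jV; rewrite memv_img ?memvf.
have actj v : v = act P (j v) p.
  by have [Uv vi] := jP v; apply: jinj; rewrite jact -?jp ?vi //; apply/numU.
have gen v : exists2 x, x \in U & v = act P x p.
  by exists (j v) => //; have [] := jP v.
have ip : act P i p = p by apply: jinj; rewrite jact -?jp //; apply/numU.
pose proper (W : {vspace P}) := submodule W /\ p \notin W.
have properP W : submodule W -> p \in W -> W = fullv.
  move=> hW Wp; apply/vspaceP=> v; rewrite memvf.
  by have [x Ux ->] := gen v; apply: hW => //; apply/numU.
have local W v : proper W -> v \in W -> exists n, (i * j v) ^+ n = 0.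
  move=> [hW Wp] Wv; have [Uv vi] := jP v.
  have e1 : i * (i * j v) = i * j v by rewrite mulrA ii.
  have e2 : i * j v * i = i * j v by rewrite -mulrA vi.
  have [//|[y [Uy yv _]]] := primitive_local UM pi (UM Ui Uv) e1 e2.
  case/negP: Wp; suff -> : p = act P (y * i) v by apply: hW => //; apply/numU/UM.
  by apply: jinj; rewrite jact -?jp -?mulrA ?yv //; apply/numU/UM.
have properD V W : proper V -> proper W -> proper (V + W)%VS.
  move=> pV pW; have [[hV _] [hW _]] := (pV, pW); split; first exact: submoduleD.
  apply/negP=> /memv_addP[v Vv [w Ww Dp]]; case/eqP: i0.
  have [n vn] := local V v pV Vv; have [m wm] := local W w pW Ww.
  have [Uv vi] := jP v.
  apply: (@nilpotent_complement _ i (i * j v) n m) => //.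
  - by rewrite mulrA ii.
  - by rewrite -mulrA vi.
  rewrite -wm; congr (_ ^+ _); rewrite -{1}ii -mulrBr; congr (_ * _).
  by rewrite jp Dp linearD addrAC subrr add0r.
have [N [hN Np] maxN] : exists2 N, proper N &
    forall W, proper W -> (N <= W)%VS -> W = N.
  apply: exists_maximal_vspace; exists 0%VS; split; first exact: submodule0.
  by rewrite memv0; apply: contraNneq i0 => p0; rewrite jp p0 linear0.
have [S [q [hq qf kq]]] := quotient_module hN.
exists P, p, S, q; split=> //.
- move=> x Ux xp; have /numU Nx := Ux.
  by rewrite jp -jact // xp linear0.
- move=> M w iw; pose h := (linfun (lfun_at w) \o (act M \o j))%VF.
  have hE v : h v = act M (j v) w by rewrite !comp_lfunE lfunE.
  exists h; last by rewrite hE -jp.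
  move=> x v Ax; rewrite !hE jact // actM //.
  by apply/numU; have [] := jP v.
split=> //; first by rewrite -memv_ker kq.
move=> W hW Wp; rewrite kq -(_ : (N + W)%VS = N) ?addvSr //.
by apply: maxN; rewrite ?addvSl //; apply: properD.
Qed.

Section Pim.

Variables (i : E) (P : amodule A) (p : P) (S : amodule A) (q : 'Hom(P, S)).
Hypotheses (Ui : i \in U) (ii : i * i = i) (PS : @pim_head i P p S q).

Lemma pim_generated (W : {vspace P}) : submodule W -> p \in W -> W = fullv.
Proof.
have [gen _ _ _ _] := PS; move=> hW Wp; apply/vspaceP=> v; rewrite memvf.
by have [x Ux ->] := gen v; apply: hW => //; apply/numU.
Qed.

Lemma pim_simple : simple S.
Proof.
have [_ _ _ _ [hq qf q0 kq]] := PS; split.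
  by apply: contraNneq q0 => S0; rewrite -memv0 -S0 memvf.
move=> W hW; rewrite -(@lpreimK _ _ _ q W); last by rewrite qf subvf.
have hV := submodule_preim hq hW; have [pV|pV] := boolP (p \in (q @^-1: W)%VS).
  by right; rewrite (pim_generated hV pV).
by left; apply/eqP; rewrite -lkerE kq.
Qed.

Lemma pim_projective_cover : projective_cover q.
Proof.
have [gen _ ip lift [hq qf q0 kq]] := PS; split=> //.
  move=> Q T g f hg gf hf.
  have /memv_imgP[w _ fp] : f p \in limg g by rewrite gf memvf.
  have Ai : sq_num A i by apply/numU.
  (* A lift is determined by the image of [p]: any preimage [w] of [f p], multiplied by [i], will
     do, because [i] fixes [p]. *)
  have [|h hh hp] := lift Q (act Q i w); first by rewrite -actM // ii.
  exists h => //; apply/lfunP=> v; have [x /numU Ax ->] := gen v.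
  by rewrite comp_lfunE hh // hg // hp hg // -fp -hf // ip hf.
move=> W hW WN; apply: pim_generated => //; apply: contraNT q0 => Wp.
have /addv_idPr := kq W hW Wp; rewrite WN => fN.
by rewrite -memv_ker -fN memvf.
Qed.

Lemma pim_act_head : act S i (q p) = q p.
Proof.
by have [_ _ ip _ [hq _ _ _]] := PS; rewrite -hq ?ip //; apply/numU.
Qed.

(** Some [i v] with [v] in [W2] avoids [W1], and [p |-> i v] extends to [h : P -> M]. Simplicity of
    [W2 / W1] makes [h] onto modulo [W1], and its kernel modulo [W1] is the largest proper submodule
    [lker q]. *)
Lemma pim_factor_iso M (W1 W2 : {vspace M}) :
  submodule W1 -> submodule W2 -> (W1 <= W2)%VS ->
  (forall W, submodule W -> (W1 <= W)%VS -> (W <= W2)%VS -> W = W1 \/ W = W2) ->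
  ~~ (act M i @: W2 <= W1)%VS -> factor_iso W1 W2 S.
Proof.
have [gen _ ip lift [hq qf q0 kq]] := PS.
move=> hW1 hW2 W12 maxW /subvPn[_ /memv_imgP[v Wv ->] W1v].
have Ai : sq_num A i by apply/numU.
have [|h hh hp] := lift M (act M i v); first by rewrite -actM // ii.
have hW x : h x \in W2.
  have [y Uy ->] := gen x; rewrite hh ?hp; last exact/numU.
  by apply: (hW2 y); [exact/numU | apply: hW2].
pose r : 'End(M) := (\1 - projv W1)%VF.
have rE w : r w = w - projv W1 w by rewrite add_lfunE opp_lfunE id_lfunE.
have kr w : (r w == 0) = (w \in W1).
  rewrite rE subr_eq0; apply/eqP/idP=> [->|/projv_id-> //]; exact: memv_proj.
have sub_h : (h @^-1: W1 <= lker q)%VS.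
  apply: kq; first exact: submodule_preim.
  by rewrite -memv_preim hp.
(* If [h] moved some [n] of [lker q] out of [W1], then [W1 + h (lker q)] would be [W2] and contain
   [h p]; some [p - m] with [m] in [lker q] would map into [W1], giving [q p = 0]. *)
have ker_h : (h @^-1: W1 = lker q)%VS.
  apply/eqP; rewrite eqEsubv sub_h /=; apply/subvP=> n Nn; apply/negPn/negP=> W1n.
  have hN := submodule_ker hq.
  have [|||EW|EW] := maxW (W1 + h @: lker q)%VS.
  - by apply: submoduleD => //; apply: submodule_img.
  - exact: addvSl.
  - by rewrite subv_add W12; apply/subvP=> _ /memv_imgP[x _ ->].
  - case/negP: W1n; rewrite -memv_preim -EW.
    by apply: subvP (addvSr _ _) _ _; apply: memv_img.
  have : h p \in W2 by [].
  rewrite -EW => /memv_addP[w1 Ww1 [_ /memv_imgP[m Nm ->] Dhp]].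
  have : p - m \in (h @^-1: W1)%VS by rewrite -memv_preim linearB /= Dhp addrK.
  move/(subvP sub_h); rewrite memv_ker linearB /= subr_eq0.
  by move: Nm; rewrite memv_ker => /eqP->; rewrite (negPf q0).
have span_W2 w : w \in W2 -> exists x, w - h x \in W1.
  have [|||EW|<-] := maxW (W1 + h @: fullv)%VS.
  - by apply: submoduleD => //; apply: submodule_img => //; apply: submodulef.
  - exact: addvSl.
  - by rewrite subv_add W12; apply/subvP=> _ /memv_imgP[x _ ->].
  - case/negP: W1v; rewrite -hp -EW.
    by apply: subvP (addvSr _ _) _ _; apply: memv_img; apply: memvf.
  case/memv_addP=> w1 Ww1 [_ /memv_imgP[x _ ->] ->].
  by exists x; rewrite addrK.
(* [r] has kernel [W1], so [g] stands for the map [P / lker q -> W2 / W1]. Here [g^-1] is only a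
   partial inverse, but its ambiguity lies in [lker g = lker q], which [q] kills. *)
pose g : 'Hom(P, M) := (r \o h)%VF.
pose f : 'Hom(M, S) := (q \o (g^-1 \o r))%VF.
have fE w x : w - h x \in W1 -> f w = q x.
  rewrite -kr linearB /= subr_eq0 -[r (h x)](comp_lfunE r h) -/g => /eqP rw.
  rewrite !comp_lfunE rw; set y := _ (g x).
  have gy : g y = g x by rewrite /y limg_lfunVK // memv_img ?memvf.
  apply/eqP; rewrite -subr_eq0 -linearB -memv_ker -ker_h -memv_preim -kr.
  by rewrite -(comp_lfunE r h) -/g linearB /= subr_eq0 gy.
exists f; split.
- move=> y w Ay Ww; have [x xw] := span_W2 w Ww.
  rewrite (fE w x xw) -hq //; apply: fE; rewrite hh // -linearB; exact: hW1.
- apply/vspaceP=> t; rewrite memvf; have : t \in limg q by rewrite qf memvf.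
  move/memv_imgP=> [x _ ->]; rewrite -(fE (h x)) ?memv_img ?subrr ?mem0v //.
apply/vspaceP=> w; rewrite memv_cap; apply/andP/idP=> [[Ww]|Ww].
  have [x xw] := span_W2 w Ww; rewrite memv_ker (fE w x xw) -memv_ker -ker_h.
  by rewrite -memv_preim => Wx; rewrite -(subrK (h x) w) memvD.
split; first exact: (subvP W12).
have w0 : w - h 0 \in W1 by rewrite linear0 subr0.
by rewrite memv_ker (fE w 0 w0) linear0.
Qed.

(** The rank of [i] is additive along a composition series: a factor isomorphic to [S] contributes
    the rank of [i] on [S], any other contributes 0 by [pim_factor_iso]. *)
Lemma pim_multiplicity M m : multiplicity M S m ->
  \dim (limg (act M i)) = (m * \dim (limg (act S i)))%N.
Proof.
move=> [r [W [K [[W0 Wr sW cW] hK <-]]]].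
have Ai : sq_num A i by apply/numU.
pose c k : nat := if insub k is Some o then o \in K else false.
have step k : (k <= r)%N ->
    \dim (act M i @: W k) = ((\sum_(j < k) c j) * \dim (limg (act S i)))%N.
  elim: k => [|k IH] kr; first by rewrite W0 limg0 dimv0 big_ord0.
  have [Wk nW maxW] := cW k kr; have [hW1 hW2] := (sW k (ltnW kr), sW k.+1 kr).
  rewrite big_ord_recr /= mulnDl -IH ?(ltnW kr) // /c insubT /=.
  have iW j v : (j <= r)%N -> v \in W j -> act M i v \in W j.
    by move=> jr Wv; apply: sW.
  have [Kk|Kk] := boolP (_ \in K); last first.
    (* By [pim_factor_iso], [i] maps [W k.+1] into [W k]; being idempotent, it has the same image on
       both. *)
    rewrite mul0n addn0; congr (\dim _); apply/eqP.
    rewrite eqEsubv [X in _ && X]limgS //.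
    rewrite andbT; apply/subvP=> _ /memv_imgP[v Wv ->].
    apply/memv_imgP; exists (act M i v); last by rewrite -actM // ii.
    apply: contraT => nWv; case/negP: Kk; apply/hK => /=.
    apply: pim_factor_iso => //; apply/subvPn; exists (act M i v) => //.
    exact: memv_img.
  move/hK: Kk => /= -[f [hf fW2 kf]]; rewrite mul1n.
  (* Rank-nullity for [f] on [i (W k.+1)]: the kernel is [i (W k)] and the image is [i S]. *)
  rewrite -(limg_ker_dim f (act M i @: W k.+1)); congr (_ + _)%N; congr (\dim _).
    apply/vspaceP=> v; rewrite memv_cap; apply/andP/memv_imgP.
      case=> /memv_imgP[w Ww ->] fw; exists (act M i w); last by rewrite -actM // ii.
      by rewrite -kf memv_cap iW.
    case=> w Ww ->; split; first by rewrite memv_img // (subvP Wk).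
    have : act M i w \in W k by rewrite iW // ltnW.
    by rewrite -kf memv_cap => /andP[].
  apply/vspaceP=> t; apply/memv_imgP/memv_imgP=> [[_ /memv_imgP[v Wv ->] ->]|[s _ ->]].
    by exists (f v); rewrite ?memvf // hf.
  have : s \in (f @: W k.+1)%VS by rewrite fW2 memvf.
  by case/memv_imgP=> v Wv ->; exists (act M i v); rewrite ?hf // memv_img.
rewrite -Wr step //. congr (_ * _)%N; rewrite -sum1_card [RHS]big_mkcond /=.
by apply: eq_bigr => k _; rewrite /c valK; case: (k \in K).
Qed.

End Pim.

(** * A surjection preserving Cartan matrices is injective *)

Section KernelOfCartanPreserving.

Variables (E' : falgType F) (A' : subquot E') (phi : 'Hom(E, E')).
Hypothesis hphi : subquot_morph A A' phi.
Hypothesis surj : forall y, sq_num A' y ->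
  exists2 x, sq_num A x & sq_den A' (y - phi x).

(* If [z <> 0], choose primitive [i] and [j] with [j * z * i <> 0].  Equality of
   the Cartan invariants at the heads of [U * i] and [U * j] says that [j] has
   the same rank on [U * i] and on the projective cover over [A'] of the same
   simple module; but the latter is a quotient of [U * i] in which
   [j * z * i] vanishes. *)
Lemma same_cartan_ker0 : same_cartan A A' phi ->
  forall z, z \in U -> sq_den A' (phi z) -> z = 0.
Proof.
move=> [simA _ cartanE] z Uz phiz; apply: contrapT => z0.
have [/numU Uu uP] := uA.
have [i [Ui ii i0 primi] zi] : exists2 i, primitive_idem U i & z * i <> 0.
  apply: (exists_primitive_idem (j := u)) => //.
  - by have [/den0/subr0_eq] := uP u (proj2 (numU u) Uu).
  - have [_ /den0/subr0_eq ->] := uP z (proj2 (numU z) Uz); exact: z0.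
  - by rewrite mulr0; apply.
  move=> x y; rewrite mulrDr; have [x0|] := EM (z * x = 0); last by left.
  by rewrite x0 add0r; right.
have [j [Uj jj j0 primj] jzi] : exists2 j, primitive_idem U j & j * (z * i) <> 0.
  apply: (exists_primitive_idem (j := u)) => //.
  - by have [/den0/subr0_eq] := uP u (proj2 (numU u) Uu).
  - by have [/den0/subr0_eq ->] := uP (z * i) (proj2 (numU _) (UM Uz Ui)).
  - by rewrite mul0r; apply.
  move=> x y; rewrite mulrDl; have [x0|] := EM (x * (z * i) = 0); last by left.
  by rewrite x0 add0r; right.
have [P [p [S [q PS]]]] := exists_pim_head (And4 Ui ii i0 primi).
have [Q [p' [T [q' QT]]]] := exists_pim_head (And4 Uj jj j0 primj).
have simS := pim_simple PS; have simT := pim_simple QT.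
have [S' simS' SS'] := simA _ simS; have [T' simT' TT'] := simA _ simT.
have [m PTm] := exists_multiplicity P T.
have cST : cartan S T m.
  by exists P, q; split=> //; exact: (pim_projective_cover Ui ii PS).
have /(cartanE S T S' T')[] := cST; rewrite //.
move=> P' [f [[_ hf ff covf] P'Tm]].
have rkP := pim_multiplicity Uj jj QT PTm.
have /(pim_multiplicity Uj jj QT) := proj2 (multiplicity_pull hphi surj _ m TT') P'Tm.
rewrite -{}rkP => rkP.
have [gen faith ip lift [hq qf q0 kq]] := PS.
have [s [s0 sf hs]] := SS'.
have Ai : sq_num A i by apply/numU.
have Aj : sq_num A j by apply/numU.
have /memv_imgP[w _ fw] : s (q p) \in limg f by rewrite ff memvf.
have [|h hh hp] := lift (pull hphi P') (act (pull hphi P') i w).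
  by rewrite -actM // ii.
(* [f] sends [h x] to [s (q x)], so [limg h] and [lker f] span [P'], and [f] is a cover. *)
have hfull : limg h = fullv.
  apply: covf; first by apply/(submodule_pull hphi surj)/submodule_img/submodulef.
  apply/vspaceP=> v; rewrite memvf.
  have /memv_imgP[x _ sx] : f v \in limg s by rewrite sf memvf.
  have : x \in limg q by rewrite qf memvf.
  case/memv_imgP=> x' _ Dx; rewrite {}Dx in sx.
  have [y /numU Ay Dx'] := gen x'.
  rewrite -(subrK (h x') v) addrC; apply: memv_add; first by rewrite memv_img ?memvf.
  rewrite memv_ker linearB /= subr_eq0 sx Dx' hq // hs // hh // hp !pullE.
  have [hN _ _ _] := hphi.
  rewrite hf ?hf; [|exact: hN..].
  by rewrite -fw -(hs i) // (pim_act_head Ui PS).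
have kerh : h (act P (j * (z * i)) p) = 0.
  rewrite hh; last by apply/numU/UM/UM.
  rewrite !actM; [|by apply/numU; rewrite ?UM..].
  by rewrite hp !pullE (act_den _ phiz) !(zero_lfunE, linear0).
(* The vector [j z i p] of [j P] is killed by [h], yet nonzero by faithfulness on the generator [p];
   so the rank of [j] drops. *)
have : (\dim (limg (act (pull hphi P') j)) < \dim (limg (act P j)))%N.
  rewrite -(limg_ker_dim h (limg (act P j))) -[X in (X < _)%N]add0n -addSn.
  rewrite -[limg (act (pull _ _) j)](_ : (h @: limg (act P j))%VS = _).
    rewrite leq_add2r lt0n dimv_eq0; apply/eqP=> k0; apply: jzi.
    have := faith (j * (z * i)); rewrite -!mulrA ii => -> //.
      by rewrite !UM.
    apply/eqP; rewrite -memv0 -k0 memv_cap memv_ker kerh eqxx andbT.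
    apply/memv_imgP; exists (act P (z * i) p); rewrite ?memvf // actM //.
    by apply/numU/UM.
  apply/vspaceP=> v; apply/memv_imgP/memv_imgP=> -[y].
    case/memv_imgP=> x _ -> ->; exists (h x); rewrite ?memvf ?hh //.
  move=> _ ->; have : y \in limg h by rewrite hfull memvf.
  case/memv_imgP=> x _ ->; exists (act P j x); rewrite ?hh //.
  by rewrite memv_img ?memvf.
by rewrite rkP ltnn.
Qed.

End KernelOfCartanPreserving.

End ProjectiveIndecomposables.

(** * Isomorphic subquotients have equal Cartan matrices *)

Section SubquotientEquivalence.

Variables (F : fieldType) (E E' : falgType F) (A : subquot E) (A' : subquot E').
Variables (phi : 'Hom(E, E')) (psi : 'Hom(E', E)).
Hypotheses (hphi : subquot_morph A A' phi) (hpsi : subquot_morph A' A psi).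
Hypothesis psiK : forall x, sq_num A x -> sq_den A (x - psi (phi x)).
Hypothesis phiK : forall y, sq_num A' y -> sq_den A' (y - phi (psi y)).

Let surj_phi y : sq_num A' y -> exists2 x, sq_num A x & sq_den A' (y - phi x).
Proof. by exists (psi y); [case: hpsi => hN _ _ _; apply: hN | apply: phiK]. Qed.

Let surj_psi x : sq_num A x -> exists2 y, sq_num A' y & sq_den A (x - psi y).
Proof. by exists (phi x); [case: hphi => hN _ _ _; apply: hN | apply: psiK]. Qed.

Lemma act_psiK (M : amodule A) x : sq_num A x -> act M (psi (phi x)) = act M x.
Proof.
by move/psiK/(act_den M)/eqP; rewrite linearB subr_eq0 => /eqP.
Qed.

Lemma act_phiK (M : amodule A') y : sq_num A' y -> act M (phi (psi y)) = act M y.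
Proof.
by move/phiK/(act_den M)/eqP; rewrite linearB subr_eq0 => /eqP.
Qed.

Lemma is_inflation_pull_psi (S : amodule A) : is_inflation phi S (pull hpsi S).
Proof.
exists \1%VF; split.
- by apply/eqP/lker0P=> v w; rewrite !id_lfunE.
- by rewrite lim1g.
by move=> x v Ax; rewrite !id_lfunE pullE act_psiK.
Qed.

Lemma is_inflation_pull_phi (S : amodule A') : is_inflation phi (pull hphi S) S.
Proof.
exists \1%VF; split.
- by apply/eqP/lker0P=> v w; rewrite !id_lfunE.
- by rewrite lim1g.
by move=> x v Ax; rewrite !id_lfunE pullE.
Qed.

Lemma is_inflation_inv (S : amodule A) (S' : amodule A') :
  is_inflation phi S S' -> is_inflation psi S' S.
Proof.
move=> [i [/eqP i0 i1 hi]].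
have iK w : i ((i^-1)%VF w) = w by rewrite limg_lfunVK // i1 memvf.
exists (i^-1)%VF; split.
- by apply/eqP/lker0P=> v w /(congr1 i); rewrite !iK.
- apply/vspaceP=> v; rewrite memvf; apply/memv_imgP.
  by exists (i v); rewrite ?memvf // lker0_lfunK.
move=> y v Ay; apply: (lker0P i0); have [hN _ _ _] := hpsi.
by rewrite hi ?iK ?act_phiK //; apply: hN.
Qed.

(** The cover [P] is restricted along [psi]. It stays projective: a lifting problem over [A'] is
    restricted along [phi], solved over [A], and its solution read back. *)
Lemma cartan_transfer (S T : amodule A) (S' T' : amodule A') m :
  is_inflation phi S S' -> is_inflation phi T T' -> cartan S T m -> cartan S' T' m.
Proof.
move=> [i [/eqP i0 i1 hi]] hT [P [f [[projP hf ff covf] PTm]]].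
have [[hN' _ _ _] [hN _ _ _]] := (hphi, hpsi).
exists (pull hpsi P), (i \o f)%VF; split; last first.
  by apply/(multiplicity_pull hpsi surj_psi)/PTm/is_inflation_inv.
split.
- move=> Q R g k hg gf hk.
  have [||h hh gh] := projP (pull hphi Q) (pull hphi R) g k _ gf.
  + exact/(is_hom_pull hphi surj_phi).
  + by move=> x v Ax; rewrite -act_psiK // -(pullE hpsi) hk ?pullE //; apply: hN'.
  exists h => // y v Ay; rewrite pullE hh; last exact: hN.
  by rewrite pullE act_phiK.
- move=> y v Ay; rewrite pullE !comp_lfunE hf ?hi ?act_phiK //; exact: hN.
- by rewrite limg_comp ff i1.
move=> W /(submodule_pull hpsi surj_psi) hW; rewrite (_ : lker _ = lker f).
  exact: covf.
apply/vspaceP=> v; rewrite !memv_ker comp_lfunE.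
by rewrite -[i _ == 0]memv_ker (eqP i0) memv0.
Qed.

End SubquotientEquivalence.

Lemma same_cartan_equiv (F : fieldType) (E E' : falgType F) (A : subquot E)
    (A' : subquot E') (phi : 'Hom(E, E')) (psi : 'Hom(E', E)) :
    subquot_morph A A' phi -> subquot_morph A' A psi ->
    (forall x, sq_num A x -> sq_den A (x - psi (phi x))) ->
    (forall y, sq_num A' y -> sq_den A' (y - phi (psi y))) ->
  same_cartan A A' phi.
Proof.
move=> hphi hpsi psiK phiK; have [[hN' _ _ _] [hN _ _ _]] := (hphi, hpsi).
split.
- move=> S simS; exists (pull hpsi S); last exact: is_inflation_pull_psi.
  apply/(simple_pull hpsi) => // x Ax.
  by exists (phi x); [apply: hN' | apply: psiK].
- move=> S' simS'; exists (pull hphi S'); last exact: is_inflation_pull_phi.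
  apply/(simple_pull hphi) => // y Ay.
  by exists (psi y); [apply: hN | apply: phiK].
move=> S T S' T' m _ _ _ _ SS' TT'; split.
  exact: (cartan_transfer hphi hpsi psiK phiK).
by apply: (cartan_transfer hpsi hphi phiK psiK);
  exact: (is_inflation_inv hpsi phiK).
Qed.

(** * The Jacobson radical *)

Section JacobsonRadical.

Variables (F : fieldType) (E : falgType F).

(** A maximal space contained in [P] exhausts [P], since the line through any further element could
    be added to it. *)
Lemma subspace_vspace (P : E -> Prop) :
    P 0 -> (forall x y, P x -> P y -> P (x - y)) ->
    (forall k x, P x -> P (k *: x)) ->
  exists V : {vspace E}, forall x, x \in V <-> P x.
Proof.
move=> P0 PB PZ.
have PD x y : P x -> P y -> P (x + y).
  by move=> Px Py; rewrite -[y]opprK -[- y]sub0r; apply/PB/PB.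
pose good (V : {vspace E}) := forall x, x \in V -> P x.
have [V gV maxV] : exists2 V, good V &
    forall W, good W -> (V <= W)%VS -> W = V.
  by apply: exists_maximal_vspace; exists 0%VS => x; rewrite memv0 => /eqP->.
exists V => x; split=> [|Px]; first exact: gV.
have gW : good (V + <[x]>)%VS.
  by move=> _ /memv_addP[v Vv [_ /vlineP[k ->] ->]]; apply: PD; [apply: gV | apply: PZ].
by rewrite -(maxV _ gW) ?addvSl // (subvP (addvSr _ _)) ?memv_line.
Qed.

Variables (U : {vspace E}) (R : set E).
Hypotheses (RU : forall x, R x <-> x \in U) (UM : mulv_closed U) (U1 : 1 \in U).

Lemma left_ideal_vspace L : left_ideal R L ->
  exists V : {vspace E}, forall x, x \in V <-> L x.
Proof.
move=> [LR L0 LB LM]; apply: subspace_vspace => // k x Lx.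
by rewrite -mulr_algl; apply: LM => //; apply/RU/memvZ.
Qed.

Lemma left_ideal1 L : left_ideal R L -> L 1 -> L = R.
Proof.
move=> [LR _ _ LM] L1; apply/funext=> x; apply/propext; split; first exact: LR.
by move=> Rx; rewrite -[x]mulr1; apply: LM.
Qed.

Lemma exists_maximal_left_ideal L0 : left_ideal R L0 -> ~ L0 1 ->
  exists2 L, maximal_left_ideal R L & (forall x, L0 x -> L x).
Proof.
move=> hL0 nL0; have [V0 V0E] := left_ideal_vspace hL0.
pose good (V : {vspace E}) := [/\ left_ideal R (fun x => x \in V), 1 \notin V
  & (V0 <= V)%VS].
have [V [hV nV V0V] maxV] : exists2 V, good V &
    forall W, good W -> (V <= W)%VS -> W = V.
  apply: exists_maximal_vspace; exists V0; split=> //; last by apply/negP=> /V0E.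
  suff -> : (fun x => x \in V0 : Prop) = L0 by [].
  by apply/funext=> x; apply/propext.
exists (fun x => x \in V); last by move=> x /V0E; apply: (subvP V0V).
split=> // [EV|L hL VL].
  by have : R 1 by [apply/RU]; rewrite -EV; apply/negP.
have [L1|nL1] := EM (L 1); first by right; apply: left_ideal1.
have [W WE] := left_ideal_vspace hL; left.
have EL : (fun x => x \in W : Prop) = L by apply/funext=> x; apply/propext.
have VW : (V <= W)%VS by apply/subvP=> x /VL/WE.
rewrite -EL; suff -> : W = V by [].
apply: maxV => //; split.
- by rewrite EL.
- by apply/negP=> /WE.
exact: subv_trans VW.
Qed.

Lemma jacobson_sub x : jacobson R x -> x \in U.
Proof. by case=> /RU. Qed.

Lemma jacobsonM a x : a \in U -> jacobson R x -> jacobson R (a * x).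
Proof.
move=> Ua [Rx Jx]; split; first by apply/RU/UM => //; apply/RU.
by move=> L mL; have [[_ _ _ LM] _ _] := mL; apply: LM; [apply/RU | apply: Jx].
Qed.

(** The Fitting idempotent [i] of [x] is in the radical. Were it nonzero, a maximal left ideal
    containing its left annihilator would contain both [i] and [i - 1]. *)
Lemma jacobson_nil x : jacobson R x -> exists n, x ^+ n = 0.
Proof.
move=> Jx; have Ux := jacobson_sub Jx.
have [y [n [Uy xy ii xn]]] := fitting UM Ux; set i := x * y in ii xn.
suff i0 : i = 0 by exists n; rewrite -xn i0 mulr0.
have Ji : jacobson R i by rewrite /i xy; apply: jacobsonM.
apply: contrapT => i0; pose L0 z := z \in U /\ z * i = 0.
have hL0 : left_ideal R L0.
  split=> [z [Uz _]||z w [Uz zi] [Uw wi]|a z Ra [Uz zi]]; first exact/RU.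
  - by split; rewrite ?mem0v ?mul0r.
  - by split; rewrite ?memvB // mulrBl zi wi subrr.
  by split; [apply: UM => //; apply/RU | rewrite -mulrA zi mulr0].
have [|L mL L0L] := exists_maximal_left_ideal hL0; first by case=> _; rewrite mul1r.
have [hL nLR _] := mL; apply: nLR; apply: left_ideal1 => //.
have Li : L i by have [_ JL] := Ji; apply: JL.
have Lc : L (i - 1).
  apply: L0L; split; first by rewrite memvB // UM.
  by rewrite mulrBl mul1r ii subrr.
by have [_ _ LB _] := hL; rewrite -(subKr i 1); apply: LB.
Qed.

(** If [x] were outside a maximal left ideal [L], then [1 = l + r * x] with [l] in [L]; by induction
    [L] contains every [1 - (r * x) ^+ k], hence 1. *)
Lemma nil_jacobson x : x \in U ->
  (forall r, r \in U -> exists n, (r * x) ^+ n = 0) -> jacobson R x.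
Proof.
move=> Ux nilx; split=> [|L mL]; first exact/RU.
have [hL nLR maxL] := mL; have [LR L0 LB LM] := hL.
have LD y z : L y -> L z -> L (y + z).
  by move=> Ly Lz; rewrite -[z]opprK -[- z]sub0r; apply/LB/LB.
apply: contrapT => nLx.
pose L' y := exists l r, [/\ L l, r \in U & y = l + r * x].
have hL' : left_ideal R L'.
  split=> [_ [l [r [Ll Ur ->]]]|||].
  - by apply/RU; rewrite memvD ?UM //; apply/RU/LR.
  - by exists 0, 0; rewrite mem0v mul0r addr0.
  - move=> _ _ [l [r [Ll Ur ->]]] [m [s [Lm Us ->]]]; exists (l - m), (r - s).
    by rewrite memvB // mulrBl opprD addrACA; split=> //; apply: LB.
  move=> a _ Ra [l [r [Ll Ur ->]]]; exists (a * l), (a * r).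
  by rewrite mulrDr mulrA; split=> //; [apply: LM | apply: UM => //; apply/RU].
have LL' : (L `<=` L')%classic.
  by move=> y Ly; exists y, 0; rewrite mem0v mul0r addr0.
have L'x : L' x by exists 0, 1; rewrite mul1r add0r.
have [E1|E1] := maxL L' hL' LL'; first by apply: nLx; rewrite -E1.
have : L' 1 by rewrite E1; apply/RU.
move=> [l [r [Ll Ur D1]]]; have [n rx] := nilx r Ur.
apply: nLR; apply: left_ideal1 => //.
suff H k : L (1 - (r * x) ^+ k) by rewrite -[1]subr0 -rx.
elim: k => [|k IH]; first by rewrite expr0 subrr.
have -> : 1 - (r * x) ^+ k.+1 = l + (r * x) * (1 - (r * x) ^+ k).
  by rewrite mulrBr mulr1 -exprS addrA -D1.
by apply: LD => //; apply: LM => //; apply/RU/UM.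
Qed.

End JacobsonRadical.

(** * Group algebras *)

Section GroupAlgebraBasics.

Variables (F : fieldType) (gT : finGroupType).
Implicit Types (a b x y : galg F gT) (g h t : gT).
Local Notation gelt := (@gelt F gT).

Lemma galgM a b g : (a * b) g = \sum_h a h * b (h^-1 * g)%g.
Proof. by rewrite ffunE. Qed.

Lemma geltM g h : gelt g * gelt h = gelt (g * h)%g.
Proof.
apply/ffunP=> k; rewrite galgM (bigD1 g) //= big1 ?addr0.
  by rewrite !ffunE eqxx mul1r (can2_eq (mulKVg g) (mulKg g)).
by move=> j /negPf jg; rewrite !ffunE jg mul0r.
Qed.

Lemma gelt1 : gelt 1%g = 1. Proof. by []. Qed.

Lemma geltV g : gelt g * gelt g^-1%g = 1.
Proof. by rewrite geltM mulgV. Qed.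

Lemma geltVl g : gelt g^-1%g * gelt g = 1.
Proof. by rewrite geltM mulVg. Qed.

Lemma gelt_mulE g a h : (gelt g * a) h = a (g^-1 * h)%g.
Proof.
rewrite galgM (bigD1 g) //= big1 ?addr0; first by rewrite ffunE eqxx mul1r.
by move=> j /negPf jg; rewrite !ffunE jg mul0r.
Qed.

Lemma mul_geltE g a h : (a * gelt g) h = a (h * g^-1)%g.
Proof.
rewrite galgM (bigD1 (h * g^-1)%g) //= big1 ?addr0.
  by rewrite ffunE invMg invgK mulgKV eqxx mulr1.
move=> j jg; rewrite !ffunE (_ : _ == g = false) ?mulr0 //.
apply: contraNF jg => /eqP <-; by rewrite invMg invgK mulKVg.
Qed.

Lemma galg_sum a : a = \sum_g a g *: gelt g.
Proof.
apply/ffunP=> h; rewrite sum_ffunE (bigD1 h) //= big1 ?addr0.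
  by rewrite !ffunE eqxx /GRing.scale /= mulr1.
by move=> g /negPf gh; rewrite !ffunE eq_sym gh /GRing.scale /= mulr0.
Qed.

Section Space.

Variable G : {group gT}.

Definition galg_restr a : galg F gT := [ffun g => if g \in G then a g else 0].

Fact galg_restr_is_linear : linear galg_restr.
Proof.
move=> k a b; apply/ffunP=> g; rewrite !ffunE.
by case: ifP => // _; rewrite /GRing.scale /= mulr0 addr0.
Qed.

HB.instance Definition _ := GRing.isLinear.Build F (galg F gT) (galg F gT) _
  galg_restr galg_restr_is_linear.

(* Sealed, because unfolding the membership test is very costly. *)
Fact galg_space_subproof :
  {V : {vspace galg F gT} | forall a, a \in V <-> group_alg F G a}.
Proof.
exists (fixedSpace (linfun galg_restr)) => a; split=> [/fixedSpaceP|aG].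
  by rewrite lfunE /= => /ffunP aG g /negPf gG; rewrite -aG ffunE gG.
apply/fixedSpaceP; rewrite lfunE /=; apply/ffunP=> g; rewrite ffunE.
by case: ifP => // /negbT/aG->.
Qed.

Definition galg_space : {vspace galg F gT} := sval galg_space_subproof.

Lemma galg_spaceP a : a \in galg_space <-> group_alg F G a.
Proof. exact: (svalP galg_space_subproof). Qed.

Lemma group_algP a : group_alg F G a <-> a \in galg_space.
Proof. by split=> /galg_spaceP. Qed.

Lemma memv_gelt g : g \in G -> gelt g \in galg_space.
Proof.
move=> Gg; apply/galg_spaceP=> h; rewrite ffunE.
by case: eqP => // -> /negP.
Qed.

Lemma memv_galg1 : 1 \in galg_space. Proof. exact: memv_gelt. Qed.

Lemma galg_space_sum a : a \in galg_space -> a = \sum_(g in G) a g *: gelt g.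
Proof.
move/galg_spaceP=> aG; rewrite [LHS]galg_sum [RHS]big_mkcond; apply: eq_bigr => g _.
by case: ifP => // /negbT/aG->; rewrite scale0r.
Qed.

Lemma galg_space_ind (P : galg F gT -> Prop) :
    (forall k x y, P x -> P y -> P (k *: x + y)) -> P 0 ->
    (forall g, g \in G -> P (gelt g)) ->
  forall a, a \in galg_space -> P a.
Proof.
move=> PD P0 Pg a /galg_space_sum->; elim/big_rec: _ => // g y Gg Py.
by apply: PD => //; apply: Pg.
Qed.

Lemma galg_space_mulv_closed : mulv_closed galg_space.
Proof.
move=> a b /galg_spaceP aG /galg_spaceP bG; apply/galg_spaceP=> g nGg.
rewrite galgM big1 // => h _; have [Gh|/aG->] := boolP (h \in G); last by rewrite mul0r.
by rewrite bG ?mulr0 // groupMl ?groupV.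
Qed.

Lemma galg_comm x : (forall g, g \in G -> x * gelt g = gelt g * x) ->
  forall a, a \in galg_space -> x * a = a * x.
Proof.
move=> xg; apply: galg_space_ind => //; last by rewrite mulr0 mul0r.
by move=> k a b xa xb; rewrite mulrDr mulrDl -scalerAr -scalerAl xa xb.
Qed.

(** The relative trace from the trivial subgroup, free of coset representatives. *)
Definition conj_trace a := \sum_(g in G) gelt g * a * gelt g^-1%g.

Lemma conj_trace_comm a y : y \in galg_space ->
  conj_trace a * y = y * conj_trace a.
Proof.
move=> Gy; apply: galg_comm Gy => h Gh; rewrite mulr_suml mulr_sumr.
rewrite [RHS](reindex_inj (mulgI h^-1%g)) /=.
apply: eq_big => [g|g _]; first by rewrite groupMl ?groupV.
rewrite invMg invgK -!geltM !mulrA; congr (_ * _ * _ * _).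
by rewrite geltV mul1r.
Qed.

Lemma conj_trace_memv a : a \in galg_space -> conj_trace a \in galg_space.
Proof.
move=> Ga; apply: memv_suml => g Gg.
by rewrite !galg_space_mulv_closed ?memv_gelt ?groupV.
Qed.

Lemma conj_traceMr a y : y \in galg_space ->
  (forall b, b \in galg_space -> b * y = y * b) ->
  conj_trace (a * y) = conj_trace a * y.
Proof.
move=> Gy Zy; rewrite mulr_suml; apply: eq_bigr => g Gg.
by rewrite -!mulrA (Zy (gelt _)) // memv_gelt ?groupV.
Qed.

Lemma rel_trace1 a : rel_trace G 1 a = conj_trace a.
Proof.
rewrite /rel_trace /conj_trace.
have -> : lcosets 1 G = [set [set g] | g in G].
  apply/setP=> X; apply/lcosetsP/imsetP=> -[g Gg ->]; exists g => //;
  by rewrite /= mulg1.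
rewrite big_imset /=; last by move=> g h _ _ /set1_inj.
by apply: eq_bigr => g _; rewrite repr_set1.
Qed.

(** A group of order [p ^ 0] is trivial whatever [p] is, and the trivial subgroup is automatically
    minimal, so only being a trace remains. *)
Lemma defect_zeroP p f : has_defect p G f 0 <->
  exists2 a, a \in galg_space & f = conj_trace a.
Proof.
split=> [[D [[_ [a [Ga _ fa]]] _]]|[a Ga fa]].
  rewrite expn0 => /card1_trivg D1; exists a; first exact/galg_spaceP.
  rewrite -fa -rel_trace1; congr (rel_trace _ _ _); exact/val_inj.
exists 1%G; last by rewrite cards1 expn0.
split; last by move=> H sH1 _; apply/val_inj/trivgP.
split; first exact: sub1G.
exists a; split; first exact/galg_spaceP; last by rewrite rel_trace1 fa.
by move=> d /set1P->; rewrite invg1 gelt1 mul1r mulr1.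
Qed.

End Space.

Lemma galg_spaceS (H G : {group gT}) a :
  H \subset G -> a \in galg_space H -> a \in galg_space G.
Proof.
move=> sHG /galg_spaceP aH; apply/galg_spaceP=> g nGg; apply: aH.
by apply: contra nGg => /(fintype.subsetP sHG).
Qed.

End GroupAlgebraBasics.

(** * Blocks of defect zero *)

Section DefectZero.

Variables (F : fieldType) (gT : finGroupType).
Implicit Types (a b x y : galg F gT) (g h t : gT).
Local Notation gelt := (@gelt F gT).
Local Notation sp := (@galg_space F gT).
Local Notation J N := (jacobson (group_alg F N)).

Let spM (N : {group gT}) := @galg_space_mulv_closed F gT N.
Let sp1 (N : {group gT}) := @memv_galg1 F gT N.

Lemma central_idemP (N : {group gT}) f :
  central_idem N f <-> f \in 'Z(sp N)%VS /\ f * f = f.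
Proof.
split=> [[/galg_spaceP Nf ff Zf]|[]].
  by split=> //; rewrite memv_cap Nf; apply/centvP=> y /galg_spaceP/Zf.
rewrite memv_cap => /andP[Nf /centvP Zf] ff; split=> //; first exact/galg_spaceP.
by move=> a /galg_spaceP/Zf.
Qed.

Lemma center_mulv_closed (N : {group gT}) : mulv_closed 'Z(sp N)%VS.
Proof.
move=> x y; rewrite !memv_cap => /andP[Nx /centvP Zx] /andP[Ny /centvP Zy].
rewrite spM //=; apply/centvP=> z Nz.
by rewrite -mulrA Zy // mulrA Zx // mulrA.
Qed.

(* Averaging a linear projection onto the left ideal [F[N] x f] with [a] makes
   it [F[N]]-linear, so this left ideal is generated by an element of [J]
   acting on it as the identity. *)
Lemma jacobson_mul_conj_trace (N : {group gT}) f a x :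
    f \in 'Z(sp N)%VS -> f * f = f -> a \in sp N -> f = conj_trace N a ->
  J N x -> x * f = 0.
Proof.
rewrite memv_cap => /andP[Nf /centvP Zf] ff Na fa Jx.
have NR := group_algP (F := F) N.
have Nx : x \in sp N := jacobson_sub NR Jx.
set v := x * f; have Nv : v \in sp N by rewrite spM.
pose L := (amulr v @: sp N)%VS.
have LP w : w \in sp N -> w * v \in L.
  by move=> Nw; apply/memv_imgP; exists w => //; rewrite lfunE.
have LM r w : r \in sp N -> w \in L -> r * w \in L.
  by move=> Nr /memv_imgP[s Ns ->]; rewrite lfunE /= mulrA; apply/LP/spM.
pose p w := \sum_(g in N) gelt g * projv L (a * gelt g^-1%g * w).
have pD k w z : p (k *: w + z) = k *: p w + p z.
  rewrite scaler_sumr -big_split; apply: eq_bigr => g _ /=.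
  by rewrite mulrDr linearD mulrDr -scalerAr linearZ -scalerAr.
have pM w : w \in sp N -> p w = w * p 1.
  move: w; apply: galg_space_ind => [k w z pw pz||h Nh].
  - by rewrite pD pw pz mulrDl scalerAl.
  - by rewrite mul0r; apply: big1 => g _; rewrite mulr0 linear0 mulr0.
  rewrite mulr_sumr [LHS](reindex_inj (mulgI h)) /=.
  apply: eq_big => [g|g Ng]; first by rewrite groupMl.
  rewrite mulr1 mulrA geltM -mulrA geltM invMg mulgKV //.
(* Each [a * gelt g^-1 * v] already lies in [L], so the projection acts trivially and the average is
   [f * v]. *)
have pv : p v = v.
  rewrite -[RHS](_ : f * v = v); last by rewrite /v mulrA Zf // -mulrA ff.
  rewrite fa mulr_suml; apply: eq_bigr => g Ng; rewrite projv_id.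
    by rewrite !mulrA.
  by rewrite LP // spM ?memv_gelt ?groupV.
have Lp : p 1 \in L.
  by apply: memv_suml => g Ng; rewrite LM ?memv_gelt ?memv_proj.
have [r Nr Dp] := memv_imgP Lp.
have Jp : J N (p 1).
  rewrite Dp lfunE /= /v -Zf // mulrA.
  by apply: (jacobsonM NR (@spM N)) => //; apply: spM.
have [n pn] := jacobson_nil NR (@spM N) (sp1 N) Jp.
suff vE k : v = v * p 1 ^+ k by rewrite (vE n) pn mulr0.
elim: k => [|k IH]; first by rewrite mulr1.
by rewrite exprS mulrA -pM // pv.
Qed.

Definition gconj g x := gelt g * x * gelt g^-1%g.

Lemma gconjM g x y : gconj g (x * y) = gconj g x * gconj g y.
Proof.
by rewrite /gconj !mulrA -(mulrA _ (gelt g^-1%g)) geltVl mulr1.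
Qed.

Lemma gconj1 g : gconj g 1 = 1.
Proof. by rewrite /gconj mulr1 geltV. Qed.

Lemma gconjB g x y : gconj g (x - y) = gconj g x - gconj g y.
Proof. by rewrite /gconj mulrBr mulrBl. Qed.

Lemma gconjK g : cancel (gconj g^-1%g) (gconj g).
Proof.
by move=> x; rewrite /gconj !mulrA geltM mulgV mul1r invgK -mulrA geltM mulgV mulr1.
Qed.

Lemma gconjE g x h : gconj g x h = x (h ^ g)%g.
Proof. by rewrite mul_geltE gelt_mulE invgK conjgE mulgA. Qed.

Section Normal.

Variables G N : {group gT}.
Hypothesis nsNG : (N <| G)%g.

Lemma gconj_memv g x : g \in G -> x \in sp N -> gconj g x \in sp N.
Proof.
move=> Gg /galg_spaceP Nx; apply/galg_spaceP=> h nNh; rewrite gconjE Nx //.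
by rewrite memJ_norm // (fintype.subsetP (normal_norm nsNG)).
Qed.

Lemma gconj_center g x : g \in G -> x \in 'Z(sp N)%VS -> gconj g x \in 'Z(sp N)%VS.
Proof.
move=> Gg; rewrite !memv_cap => /andP[Nx /centvP Zx].
rewrite gconj_memv //=; apply/centvP=> y Ny.
have Ny' : gconj g^-1%g y \in sp N by rewrite gconj_memv ?groupV.
by rewrite -(gconjK g y) -!gconjM Zx.
Qed.

Lemma gconj_trace g x : g \in G -> gconj g (conj_trace N x) = conj_trace N (gconj g x).
Proof.
move=> Gg; rewrite /gconj mulr_sumr mulr_suml.
rewrite [RHS](reindex_inj (conjg_inj g^-1%g)) /=.
apply: eq_big => [h|h _].
  by rewrite memJ_norm // groupV (fintype.subsetP (normal_norm nsNG)).
have E h' : gelt (h' ^ g^-1)%g = gconj g (gelt h').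
  by rewrite /gconj !geltM conjgE invgK mulgA.
by rewrite -conjVg !E -/(gconj g x) -!gconjM.
Qed.

(* The least central idempotent [c] of [F[N]] such that [1 - c] is a trace is
   fixed by [G] and annihilates [f]; hence [e * c = 0], whereas [x * c = x] for
   all [x] in the radical. *)
Lemma jacobson_mul_covering_block p e f :
    block_idem G e -> central_idem N f -> block_covers e f -> has_defect p N f 0 ->
  forall x, J N x -> x * e = 0.
Proof.
move=> [[/galg_spaceP Ge ee Ze] _ prime_e] /central_idemP[Zf ff] ef.
move=> /defect_zeroP[a Na fa] x Jx.
pose good c := [/\ c \in 'Z(sp N)%VS, c * c = c &
  exists2 b, b \in sp N & 1 - c = conj_trace N b].
have Z1 : 1 \in 'Z(sp N)%VS.
  by rewrite memv_cap sp1; apply/centvP=> y; rewrite mulr1 mul1r.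
have goodf : good (1 - f).
  split; first by rewrite memvB.
    by rewrite mulrBr mulr1 mulrBl ff mul1r subrr subr0.
  by exists a => //; rewrite subKr.
have goodM c d : good c -> good d -> good (c * d).
  move=> [Zc cc [b Nb Dc]] [Zd dd [b' Nb' Dd]].
  move: (Zc) (Zd); rewrite !memv_cap => /andP[Nc /centvP cC] /andP[Nd /centvP dC].
  split; first exact: center_mulv_closed.
    by rewrite mulrA -(mulrA c) -cC // mulrA cc -mulrA dd.
  exists (b + b' * c); first by apply: memvD => //; apply: spM.
  rewrite (_ : 1 - c * d = (1 - c) + (1 - d) * c); last first.
    by rewrite mulrBl mul1r -cC // addrA subrK.
  rewrite Dc Dd -conj_traceMr //; last by move=> y Ny; rewrite cC.
  by rewrite -big_split; apply: eq_bigr => g _; rewrite mulrDr mulrDl.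
have goodJ g c : g \in G -> good c -> good (gconj g c).
  move=> Gg [Zc cc [b Nb Dc]]; split; first exact: gconj_center.
    by rewrite -gconjM cc.
  exists (gconj g b); first exact: gconj_memv.
  by rewrite -gconj_trace // -Dc gconjB gconj1.
(* For [c] of minimal rank, [c * d] is again good and generates the same left ideal as [c], which
   forces [c * d = c]. *)
have [c goodc minc] : exists2 c, good c & forall d, good d -> c * d = c.
  have [c goodc minc] :=
    exists_minimal (fun c => \dim (limg (amulr c))) (ex_intro _ _ goodf).
  exists c => // d goodd; have [[Zc cc _] [_ dd _]] := (goodc, goodd).
  have [Zd _ _] := goodd.
  have cd : c * d = d * c.
    move: Zc Zd; rewrite !memv_cap => /andP[_ /centvP cC] /andP[Nd _]; exact: cC.
  have /eqP E1 : limg (amulr (c * d)) == limg (amulr c).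
    rewrite eqEdim minc ?andbT; last exact: goodM.
    apply/subvP=> _ /memv_imgP[y _ ->]; rewrite lfunE /= cd mulrA.
    by apply/memv_imgP; exists (y * d); rewrite ?memvf // lfunE.
  have : c \in limg (amulr c).
    by apply/memv_imgP; exists 1; rewrite ?memvf // lfunE /= mul1r.
  rewrite -E1 => /memv_imgP[y _]; rewrite lfunE /= => Dc.
  by rewrite {1}Dc -!mulrA dd.
have [Zc cc [b Nb Dc]] := goodc.
move: Zc; rewrite memv_cap => /andP[Nc /centvP Zc].
(* Minimality against the conjugates by [g] and [g^-1] makes [c] and its conjugate absorb each
   other; they commute, so they coincide. *)
have cJ g : g \in G -> gconj g c = c.
  move=> Gg; have cgc : gconj g c * c = gconj g c.
    have := minc _ (goodJ g^-1%g c (groupVr Gg) goodc).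
    by move/(congr1 (gconj g)); rewrite gconjM gconjK.
  by rewrite -[RHS](minc _ (goodJ g c Gg goodc)) Zc ?gconj_memv // cgc.
have Gc : c \in sp G := galg_spaceS (normal_sub nsNG) Nc.
have cG y : y \in sp G -> y * c = c * y.
  move=> Gy; apply/esym; apply: galg_comm Gy => g Gg.
  by rewrite -[X in X * _](cJ g Gg) /gconj -mulrA geltVl mulr1.
have eZ y : y \in sp G -> y * e = e * y by move/galg_spaceP; apply: Ze.
have central d : d \in sp G -> d * d = d ->
    (forall y, y \in sp G -> y * d = d * y) ->
    central_idem G (e * d).
  move=> Gd dd dC; split.
  - by apply/galg_spaceP/galg_space_mulv_closed.
  - by rewrite mulrA -(mulrA e) (eZ d) // mulrA ee -mulrA dd.
  by move=> y /galg_spaceP Gy; rewrite mulrA eZ // -!mulrA dC.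
have cd1 : c * (1 - c) = 0 by rewrite mulrBr mulr1 cc subrr.
have cf : c * f = 0.
  have /eqP := minc _ goodf.
  by rewrite mulrBr mulr1 subr_eq addrC -subr_eq subrr => /eqP.
(* [e] splits into orthogonal central idempotents [e * c] and [e * (1 - c)]. The second cannot
   vanish, since [c * f = 0] while [e * f] is nonzero; so [e * c = 0]. *)
have [||||ec|ec] := prime_e (e * c) (e * (1 - c)).
- exact: central.
- apply: central; rewrite ?memvB ?memv_galg1 //.
    by rewrite mulrBl mul1r cd1 subr0.
  by move=> y Gy; rewrite mulrBr mulrBl mulr1 mul1r cG.
- by rewrite mulrA -(mulrA e) (eZ c) // mulrA ee -mulrA cd1 mulr0.
- by rewrite -mulrDr addrC subrK mulr1.
- have xc : x * (1 - c) = 0.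
    apply: jacobson_mul_conj_trace Nb Dc Jx.
      by rewrite memvB // memv_cap Nc; apply/centvP.
    by rewrite mulrBl mul1r cd1 subr0.
  have -> : x * e = x * c * e.
    by apply/eqP; rewrite -subr_eq0 -mulrBl -{1}[x]mulr1 -mulrBr xc mul0r.
  by rewrite -mulrA eZ // ec mulr0.
case/eqP: ef; move/eqP: ec; rewrite mulrBr mulr1 subr_eq0 => /eqP ->.
by rewrite -mulrA cf mulr0.
Qed.

End Normal.

End DefectZero.

(** * Corner algebras over a splitting field *)

Section SplittingCorner.

Import passmx.

Variables (F : fieldType) (gT : finGroupType) (N : {group gT}).
Implicit Types (x y r i : galg F gT) (g h : gT).
Local Notation gelt := (@gelt F gT).
Local Notation sp := (@galg_space F gT).
Let spM := @galg_space_mulv_closed F gT N.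

(* The hypothesis says that the right ideal [i F[N]] is simple. *)
Lemma splitting_corner i : group_splitting_field F N ->
    i \in sp N -> i * i = i -> i != 0 ->
    (forall v, v \in sp N -> i * v = v -> v != 0 ->
      exists2 r, r \in sp N & v * r = i) ->
  forall x, x \in sp N -> exists c : F, i * x * i = c *: i.
Proof.
move=> splitN Ni ii i0 simpi x Nx.
pose W := (amull i @: sp N)%VS.
have WP y : y \in W <-> y \in sp N /\ i * y = y.
  split=> [/memv_imgP[z Nz ->]|[Ny iy]].
    by rewrite lfunE /= mulrA ii; split=> //; apply: spM.
  by apply/memv_imgP; exists y => //; rewrite lfunE.
pose V := subvs_of W.
pose lift (b : 'End(galg F gT)) : 'End(V) :=
  (linfun (vsproj W) \o (b \o linfun vsval))%VF.
have liftE (b : 'End(galg F gT)) (v : V) : b (vsval v) \in W ->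
    vsval (lift b v) = b (vsval v).
  move=> Wbv; rewrite !comp_lfunE [linfun vsval v]lfunE.
  have -> z : linfun (vsproj W) z = vsproj W z by exact: lfunE.
  by rewrite vsprojK.
pose a g := lift (amulr (gelt g)).
have aE g (v : V) : g \in N -> vsval (a g v) = vsval v * gelt g.
  move=> Ng; rewrite liftE lfunE //=; have /WP[Nv iv] := subvsP v.
  by apply/WP; rewrite mulrA iv; split=> //; apply: spM; rewrite ?memv_gelt.
pose b := lift (amull (i * x * i)).
have bE (v : V) : vsval (b v) = i * x * i * vsval v.
  rewrite liftE lfunE //=; have /WP[Nv iv] := subvsP v.
  by apply/WP; rewrite !mulrA ii; split=> //; rewrite !spM.
pose e := vbasis {:V}; have be : basis_of {:V} e := vbasisP _.
have fe := basis_free be.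
(* Matrices act on row vectors, so right multiplication by [N] gives a representation and not an
   antirepresentation. *)
have rep : mx_repr N (fun g => mxof e e (a g)).
  split.
    rewrite -(mxof1 fe); congr (mxof _ _ _); apply/lfunP=> v; apply: val_inj.
    by rewrite /= aE // gelt1 mulr1 id_lfunE.
  move=> g h Ng Nh /=; rewrite -(mxof_comp e e be); congr (mxof _ _ _).
  apply/lfunP=> v; apply: val_inj; rewrite /= comp_lfunE !aE ?groupM //.
  by rewrite -mulrA geltM.
pose rG := MxRepresentation rep.
have Wi : i \in W by apply/WP.
have vi : vsval (vsproj W i) = i by rewrite vsprojK.
(* A nonzero submodule contains some [v] nonzero, hence [i = v * r], hence all of [W = i F[N]]. *)
have irrG : mx_irreducible rG.
  apply/mx_irrP; split.
    rewrite lt0n; apply: contraNneq i0 => n0; rewrite -vi.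
    suff -> : vsproj W i = 0 by rewrite linear0.
    have : vsproj W i \in fullv by apply: memvf.
    by move/eqP: n0; rewrite dimv_eq0 => /eqP->; rewrite memv0 => /eqP.
  move=> M /mxmoduleP modM M0.
  have stable (v : V) r : r \in sp N -> v \in vsof e M ->
      vsproj W (vsval v * r) \in vsof e M.
    move=> + Mv; move: r; apply: galg_space_ind => [k y z My Mz||g Ng].
    - by rewrite mulrDr -scalerAr linearP memvD ?memvZ.
    - by rewrite mulr0 linear0 mem0v.
    rewrite -aE // vsvalK -(rVof_sub be) (rVof_app e be).
    move: Mv; rewrite -(rVof_sub be) => Mv.
    exact: submx_trans (submxMr _ Mv) (modM g Ng).
  have [v Mv v0] : exists2 v, v \in vsof e M & v != 0.
    by exists (vpick (vsof e M)); rewrite ?memv_pick // vpick0 (vsof_eq0 be).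
  have /WP[Nv iv] := subvsP v.
  have [|r Nr vr] := simpi _ Nv iv.
    by apply: contraNneq v0 => v0; apply/eqP/val_inj; rewrite /= v0.
  have Mi : vsproj W i \in vsof e M by rewrite -vr stable.
  rewrite -sub1mx; apply/row_subP=> k.
  rewrite -[row _ _](vecofK be) (rVof_sub be).
  set w := vecof _ _; have /WP[Nw iw] := subvsP w.
  by rewrite -(vsvalK w) -iw -{1}vi stable.
(* Left multiplication by [i * x * i] commutes with right multiplications, so absolute
   irreducibility makes it a scalar, read off at [i]. *)
have cent : centgmx rG (mxof e e b).
  apply/centgmxP=> g Ng /=; rewrite -!(mxof_comp e e be); congr (mxof _ _ _).
  apply/lfunP=> v; apply: val_inj.
  rewrite /= (comp_lfunE (a g) b) (comp_lfunE b (a g)).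
  by rewrite aE // !bE aE // mulrA.
have /is_scalar_mxP[c bc] := mx_abs_irr_cent_scalar (splitN _ rG irrG) cent.
exists c; have : b = c *: \1%VF.
  apply: (can_inj (mxofK be be)); rewrite bc linearZ /= (mxof1 fe).
  by rewrite scalemx1.
move/lfunP/(_ (vsproj W i))/(congr1 vsval).
by rewrite bE scale_lfunE id_lfunE linearZ /= vi -mulrA ii.
Qed.

(* Any splitting idempotent [i] satisfies [i * Tr(i) * i = (i 1)^-1 *: i], by
   the symmetry of the form [x, y |-> (x * y) 1]. *)
Lemma splitting_idem_trace i : i \in sp N -> i * i = i -> i != 0 ->
    (forall x, x \in sp N -> exists c : F, i * x * i = c *: i) ->
  exists2 c : F, c != 0 & conj_trace N i * i = c *: i.
Proof.
move=> Ni ii i0 corner.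
have symE x y : (x * y) 1%g = (y * x) 1%g.
  rewrite !galgM [RHS](reindex_inj invg_inj); apply: eq_bigr => h _.
  by rewrite !mulg1 invgK mulrC.
pose l := i 1%g.
have iE g : (i * gelt g^-1%g) 1%g = i g by rewrite mul_geltE invgK mul1g.
have cE x c : i * x * i = c *: i -> (i * x) 1%g = c * l.
  move=> E; have : (i * x * i) 1%g = c * l by rewrite E ffunE.
  by rewrite symE !mulrA ii.
(* If [i 1] were zero, the corner condition would annihilate [(i * gelt g^-1) 1], which is the
   coefficient of [i] at [g]. *)
have l0 : l != 0.
  apply: contraNneq i0 => l0; apply/eqP/ffunP=> g; rewrite [RHS]ffunE.
  have [Ng|nNg] := boolP (g \in N); last by move/galg_spaceP: Ni => ->.
  have [c /cE] := corner _ (memv_gelt F (groupVr Ng)).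
  by rewrite iE l0 mulr0.
have corE x : x \in sp N -> i * x * i = ((i * x) 1%g / l) *: i.
  by move=> Nx; have [c Ec] := corner x Nx; rewrite Ec (cE _ _ Ec) mulfK.
exists l^-1; first by rewrite invr_eq0.
rewrite -{2}ii mulrA conj_trace_comm // mulr_sumr mulr_suml.
(* The summand is [i * gelt g * i * gelt g^-1 * i]. Both corners are multiples of [i], by the
   coefficients of [i] at [g^-1] and [g] divided by [l]; the products sum to
   [(i * i) 1 / (l * l)]. *)
under eq_bigr => g Ng.
  rewrite 2!mulrA corE ?memv_gelt // -!scalerAl corE ?memv_gelt ?groupV //.
  rewrite iE -{1}[g]invgK iE scalerA; over.
rewrite /= -scaler_suml; congr (_ *: _).
transitivity ((i * i) 1%g / (l * l)); last first.
  by rewrite ii -/l invfM mulrA mulfV // mul1r.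
rewrite galgM mulr_suml [RHS](bigID (mem N)) /= [X in _ + X]big1 ?addr0.
  apply: eq_bigr => g Ng; rewrite mulg1 invfM.
  by rewrite mulrACA [i g * _]mulrC.
by move=> g nNg; move/galg_spaceP: Ni => ->; rewrite ?mul0r.
Qed.

End SplittingCorner.

(** * Covered blocks, and coordinates along the cosets of [N] *)

Section CoveredBlocks.

Variables (F : fieldType) (gT : finGroupType) (G N : {group gT}).
Hypothesis sNG : N \subset G.
Implicit Types (x y r e f i : galg F gT) (g h t : gT).
Local Notation gelt := (@gelt F gT).
Local Notation sp := (@galg_space F gT).
Local Notation J := (jacobson (group_alg F N)).

Let spM := @galg_space_mulv_closed F gT N.
Let NR := group_algP (F := F) N.

Lemma primitive_center_block f : primitive_idem 'Z(sp N)%VS f -> block_idem N f.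
Proof.
move=> [Zf ff f0 prim]; split=> //; first exact/central_idemP.
move=> a b /central_idemP[Za aa] /central_idemP[Zb bb] ab0 fab.
have ba0 : b * a = 0.
  move: Za Zb; rewrite !memv_cap => /andP[Na /centvP Ca] /andP[Nb _].
  by rewrite -Ca.
have [||//|fa] := prim a Za aa.
- by rewrite fab mulrDl aa ba0 addr0.
- by rewrite fab mulrDr aa ab0 addr0.
- by left.
by right; move: fab => /eqP; rewrite fa addrC -subr_eq subrr eq_sym => /eqP.
Qed.

Lemma exists_covered_block e : e != 0 ->
  exists2 f, primitive_idem 'Z(sp N)%VS f & e * f <> 0.
Proof.
move=> e0; apply: (exists_primitive_idem (j := 1)).
- by rewrite memv_cap memv_galg1; apply/centvP=> y; rewrite mulr1 mul1r.
- by rewrite mulr1.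
- by rewrite mulr1; apply/eqP.
- by rewrite mulr0; apply.
move=> x y; rewrite mulrDr; have [x0|] := EM (e * x = 0); last by left.
by rewrite x0 add0r; right.
Qed.

(* The [F[N]]-coordinate of [y] on the coset of [t]. *)
Definition galg_coset t y : galg F gT := galg_restr N (gelt t^-1%g * y).

Lemma galg_restr_memv y : galg_restr N y \in sp N.
Proof. by apply/galg_spaceP=> g /negPf nNg; rewrite ffunE nNg. Qed.

Lemma galg_restrM y r : r \in sp N -> galg_restr N (y * r) = galg_restr N y * r.
Proof.
move=> Nr; apply/ffunP=> g; rewrite [RHS]galgM ffunE galgM.
move/galg_spaceP: (Nr) => rN; case: ifP => [Ng|/negbT nNg].
  apply: eq_bigr => h _; rewrite [in RHS]ffunE; case: ifP => // /negbT nNh.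
  by rewrite rN ?mulr0 ?mul0r // groupMr // groupV.
rewrite big1 // => h _; rewrite [in LHS]ffunE.
case: ifP => [Nh|_]; last by rewrite mul0r.
by rewrite rN ?mulr0 // groupMl ?groupV.
Qed.

Lemma galg_cosetM t y r : r \in sp N -> galg_coset t (y * r) = galg_coset t y * r.
Proof. by move=> Nr; rewrite /galg_coset mulrA galg_restrM. Qed.

(** [F[gT]] is a free right [F[N]]-module on coset representatives, taken to be the [t] equal to
    [repr] of their own coset. *)
Lemma galg_coset_sum y :
  y = \sum_(t | t == repr (t *: N)%g) gelt t * galg_coset t y.
Proof.
apply/ffunP=> g; rewrite sum_ffunE.
have Ng : repr (g *: N)%g \in (g *: N)%g by apply: (mem_repr g); apply: lcoset_refl.
have cg := lcoset_eqP Ng; rewrite (bigD1 (repr (g *: N)%g)) /=; last by rewrite cg.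
rewrite big1 ?addr0.
  rewrite gelt_mulE ffunE -mem_lcoset cg lcoset_refl gelt_mulE invgK mulKVg //.
move=> t /andP[/eqP Dt tg]; rewrite gelt_mulE ffunE -mem_lcoset.
by case: ifP => // /lcoset_eqP tN; rewrite tN -Dt eqxx in tg.
Qed.

(** For [t] in [G], [e] commutes with [t]; for [t] outside, the coordinate is 0, as [y] is supported
    in [G] and [N] lies in [G]. *)
Lemma mul_galg_coset e y t :
    (forall x, x \in sp G -> x * e = e * x) -> y \in sp G ->
  e * (gelt t * galg_coset t y) = gelt t * (e * galg_coset t y).
Proof.
move=> eC Gy; have [Gt|nGt] := boolP (t \in G).
  by rewrite mulrA -eC ?memv_gelt // -mulrA.
rewrite (_ : galg_coset t y = 0) ?mulr0 //.
apply/ffunP=> g; rewrite [LHS]ffunE [RHS]ffunE.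
case: ifP => // Ng; rewrite gelt_mulE invgK.
by move/galg_spaceP: Gy; apply; rewrite groupMr // (fintype.subsetP sNG).
Qed.

Variable e : galg F gT.
Hypotheses (Ge : e \in sp G) (ee : e * e = e).
Hypothesis eC : forall x, x \in sp G -> x * e = e * x.

(** The coordinates of a right [N]-invariant [e] are multiples of the sum [s] over [N]. If [#|N|]
    were zero in [F], then [e * s = 0], so [e = e * e] would vanish. *)
Lemma fixed_idem_card : e != 0 -> (forall g, g \in N -> e * gelt g = e) ->
  #|N|%:R != 0 :> F.
Proof.
move=> e0 eN; apply: contraNneq e0 => N0.
pose s := \sum_(g in N) gelt g.
have es : e * s = 0.
  by rewrite mulr_sumr (eq_bigr (fun=> e)) // sumr_const -scaler_nat N0 scale0r.
rewrite -ee {2}(galg_coset_sum e) mulr_sumr big1 // => t _.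
rewrite mul_galg_coset // (_ : galg_coset t e = e t *: s).
  by rewrite -scalerAr es scaler0 mulr0.
apply/ffunP=> g; rewrite [LHS]ffunE gelt_mulE invgK [RHS]ffunE sum_ffunE.
have [Ng|nNg] := boolP (g \in N).
  rewrite (bigD1 g) //= ffunE eqxx big1 => [|h /andP[_ /negPf hg]].
    rewrite addr0 /GRing.scale /= mulr1.
    by rewrite -[in LHS](eN g Ng) mul_geltE mulgK.
  by rewrite ffunE eq_sym hg.
rewrite big1 ?scaler0 // => h Nh; rewrite ffunE; case: eqP => // gh.
by rewrite gh Nh in nNg.
Qed.

Hypothesis Je : forall x, J x -> x * e = 0.

Lemma not_jacobson_not_nil x : x \in sp N -> ~ J x ->
  exists2 r, r \in sp N & ~ exists n, (r * x) ^+ n = 0.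
Proof.
move=> Nx nJx; apply: contrapT => nr; apply: nJx.
apply: (nil_jacobson NR spM (memv_galg1 F N)) => // r Nr.
by apply: contrapT => nil_rx; apply: nr; exists r.
Qed.

(* The coordinates of [e] are annihilated by [J] on the right, and by primitivity
   one of them generates a left ideal containing [i]. *)
Lemma primitive_mul_jacobson i :
  primitive_idem (sp N) i -> e * i <> 0 -> forall x, J x -> i * x = 0.
Proof.
move=> pi ei x Jx; have [Ni ii i0 _] := pi.
have NG y : y \in sp N -> y \in sp G by apply: galg_spaceS.
have eJ y : J y -> e * y = 0.
  by move=> Jy; rewrite -eC ?Je //; apply/NG/(jacobson_sub NR).
(* If all coordinates of [e * i] lay in the radical, [e] would annihilate them, and
   [e * i = e * (e * i)] would vanish. *)
have [t zJ] : exists t, ~ J (galg_coset t e * i).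
  apply: contrapT => nt; apply: ei.
  have Gei : e * i \in sp G by apply: galg_space_mulv_closed => //; apply: NG.
  rewrite -ee -mulrA (galg_coset_sum (e * i)) mulr_sumr big1 // => t _.
  rewrite mul_galg_coset // galg_cosetM // eJ ?mulr0 //.
  by apply: contrapT => zJ; apply: nt; exists t.
move Dz : (galg_coset t e * i) zJ => z zJ.
have zi : z * i = z by rewrite -Dz -mulrA ii.
have Nz : z \in sp N by rewrite -Dz spM // galg_restr_memv.
have [r Nr nil_rz] := not_jacobson_not_nil Nz zJ.
have Nirz : i * (r * z) \in sp N by rewrite !spM.
have e1 : i * (i * (r * z)) = i * (r * z) by rewrite mulrA ii.
have e2 : i * (r * z) * i = i * (r * z) by rewrite -!mulrA zi.
have [nil_irz|[y [Ny yi _]]] := primitive_local spM pi Nirz e1 e2.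
  by case: nil_rz; rewrite -zi mulrA; apply: nilpotent_swap.
have Jix : J (i * x) by apply: (jacobsonM NR spM).
(* Writing [i] as a left multiple of [z] brings in the coordinate of [e * (i * x)], which is zero
   since [i * x] lies in the radical. *)
rewrite -yi -Dz -!mulrA -galg_cosetM ?eJ //; last exact: jacobson_sub Jix.
by rewrite /galg_coset mulr0 linear0 !mulr0.
Qed.

(** Since [v = i * v] is nonzero, [v] is not in the radical, so some [r * v] is not nilpotent. Then
    neither is [v * (r * i)], which is thus invertible in the local corner of [i]. *)
Lemma primitive_right_simple i : primitive_idem (sp N) i ->
    (forall x, J x -> i * x = 0) ->
  forall v, v \in sp N -> i * v = v -> v != 0 ->
  exists2 r, r \in sp N & v * r = i.
Proof.
move=> pi iJ v Nv iv v0; have [Ni ii _ _] := pi.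
have nJv : ~ J v by move/iJ; rewrite iv; apply/eqP.
have [r Nr nil_rv] := not_jacobson_not_nil Nv nJv.
have Nvri : v * (r * i) \in sp N by rewrite !spM.
have e1 : i * (v * (r * i)) = v * (r * i) by rewrite mulrA iv.
have e2 : v * (r * i) * i = v * (r * i) by rewrite -!mulrA ii.
have [nil_vri|[y [Ny _ iy]]] := primitive_local spM pi Nvri e1 e2.
  by case: nil_rv; rewrite -iv mulrA; apply: nilpotent_swap.
by exists (r * i * y); rewrite ?spM // mulrA.
Qed.

Lemma covered_block_defect_zero p f : group_splitting_field F N ->
  primitive_idem 'Z(sp N)%VS f -> e * f <> 0 -> has_defect p N f 0.
Proof.
move=> splitN pf ef; have [Zf ff _ _] := pf.
move: (Zf); rewrite memv_cap => /andP[Nf /centvP fC].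
have [i pi efi] : exists2 i, primitive_idem (sp N) i & e * f * i <> 0.
  apply: (exists_primitive_idem (j := 1)); rewrite ?memv_galg1 ?mulr1 //.
    by rewrite mulr0; apply.
  move=> x y; rewrite mulrDr; have [x0|] := EM (e * f * x = 0); last by left.
  by rewrite x0 add0r; right.
have [Ni ii i0 prim] := pi.
have fi : f * i = i.
  have [||||fi0|//] := prim (f * i); rewrite ?spM //.
  - by rewrite -mulrA (mulrA i) -fC // -mulrA ii mulrA ff.
  - by rewrite mulrA -fC // -mulrA ii.
  - by rewrite -mulrA ii.
  by case: efi; rewrite -mulrA fi0 mulr0.
have ei : e * i <> 0 by rewrite -fi mulrA.
have iJ := primitive_mul_jacobson pi ei.
have corner := splitting_corner splitN Ni ii i0 (primitive_right_simple pi iJ).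
have [c c0 ci] := splitting_idem_trace Ni ii i0 corner.
pose T := conj_trace N i; have NT : T \in sp N by apply: conj_trace_memv.
have ZT : T \in 'Z(sp N)%VS.
  by rewrite memv_cap NT; apply/centvP=> y; apply: conj_trace_comm.
have ZTf : T * f \in 'Z(sp N)%VS by apply: center_mulv_closed.
have e1 : f * (T * f) = T * f by rewrite fC ?spM // -mulrA ff.
have e2 : T * f * f = T * f by rewrite -mulrA ff.
(* [T * i = c *: i] keeps [T * f] from being nilpotent; its inverse [y] in the local centre then
   makes [f] the trace of [i * (f * y)]. *)
have [[n nil]|[y [Zy _ Ty]]] :=
    primitive_local (@center_mulv_closed F gT N) pf ZTf e1 e2.
  case/eqP: i0; have : (T * f) ^+ n * i = c ^+ n *: i.
    elim: n {nil} => [|n IH]; first by rewrite mul1r scale1r.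
    by rewrite exprSr -mulrA -(mulrA T) fi /T ci -scalerAr IH scalerA exprS.
  rewrite nil mul0r => /esym/eqP; rewrite scaler_eq0 expf_eq0 (negPf c0) andbF.
  by move/eqP.
move: (Zy); rewrite memv_cap => /andP[Ny /centvP yC].
apply/defect_zeroP; exists (i * (f * y)); first by rewrite !spM.
rewrite conj_traceMr ?spM // ?mulrA ?Ty // => b Nb.
by rewrite mulrA -fC // -!mulrA yC.
Qed.

End CoveredBlocks.

(** * Images of blocks *)

Lemma same_cartan_idE (F : fieldType) (E : falgType F) (A A' : subquot E) :
  same_cartan A A' id <-> same_cartan A A' (\1%VF : 'End(E)).
Proof.
by have -> : id = \1%VF :> (E -> E) by apply/funext=> x; rewrite id_lfunE.
Qed.

Section GroupAlgebraMap.

Variables (F : fieldType) (gT rT : finGroupType).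

Fact galg_map_is_linear (f : gT -> rT) : linear (@galg_map F gT rT f).
Proof.
move=> k a b; rewrite /galg_map scaler_sumr -big_split; apply: eq_bigr => g _ /=.
by rewrite !ffunE scalerDl scalerA.
Qed.

HB.instance Definition _ f := GRing.isLinear.Build F (galg F gT) (galg F rT) _
  (@galg_map F gT rT f) (galg_map_is_linear f).

Lemma galg_map_gelt (f : gT -> rT) g : galg_map f (gelt F g) = gelt F (f g).
Proof.
rewrite /galg_map (bigD1 g) //= big1 ?addr0; first by rewrite ffunE eqxx scale1r.
by move=> h /negPf hg; rewrite ffunE hg scale0r.
Qed.

Lemma galg_mapM (G D : {group gT}) (f : {morphism D >-> rT}) a b : G \subset D ->
  a \in galg_space F G -> b \in galg_space F G ->
  galg_map f (a * b) = galg_map f a * galg_map f b.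
Proof.
move=> /fintype.subsetP sGD Ga; move: b; apply: galg_space_ind => [k x y Ex Ey||h Gh].
- by rewrite mulrDr -scalerAr !linearP /= Ex Ey mulrDr -scalerAr.
- by rewrite mulr0 linear0 mulr0.
move: a Ga; apply: galg_space_ind => [k x y Ex Ey||g Gg].
- by rewrite mulrDl -scalerAl !linearP /= Ex Ey mulrDl -scalerAl.
- by rewrite mul0r linear0 mul0r.
by rewrite geltM !galg_map_gelt geltM morphM ?sGD.
Qed.

End GroupAlgebraMap.

Section BlockImages.

Variables (F : fieldType) (gT : finGroupType) (G N : {group gT}) (e : galg F gT).
Local Notation sp := (@galg_space F gT).
Local Notation J := (jacobson (group_alg F N)).
Hypothesis nsNG : (N <| G)%g.
Hypothesis he : central_idem G e.

Let B := block_subquot G e.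
Let U : {vspace galg F gT} := (amulr e @: sp G)%VS.

Let Ge : e \in sp G. Proof. by case: he => /galg_spaceP. Qed.
Let ee : e * e = e. Proof. by case: he. Qed.
Let eC x : x \in sp G -> x * e = e * x.
Proof. by case: he => _ _ Ze /galg_spaceP/Ze. Qed.

Lemma block_memv x : x \in U <-> x \in sp G /\ x * e = x.
Proof.
split=> [/memv_imgP[y Gy ->]|[Gx xe]].
  by rewrite lfunE /= -mulrA ee; split=> //; apply: galg_space_mulv_closed.
by apply/memv_imgP; exists x => //; rewrite lfunE.
Qed.

Lemma block_num x : sq_num B x <-> x \in U.
Proof.
split=> [[a /galg_spaceP Ga <-]|/block_memv[/galg_spaceP Gx xe]]; last by exists x.
by apply/memv_imgP; exists a => //; rewrite lfunE.
Qed.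

Lemma block_den x : sq_den B x <-> x = 0. Proof. by []. Qed.

Lemma block_mulv_closed : mulv_closed U.
Proof.
move=> x y /block_memv[Gx xe] /block_memv[Gy ye]; apply/block_memv.
by rewrite -mulrA ye; split=> //; apply: galg_space_mulv_closed.
Qed.

Lemma block_identity : is_identity B e.
Proof.
split=> [|x /block_num/block_memv[Gx xe]]; first exact/block_num/block_memv.
by rewrite -eC // xe subrr.
Qed.

Lemma block_same_cartan_ker0 (E' : falgType F) (A' : subquot E')
    (phi : 'Hom(galg F gT, E')) :
    subquot_morph B A' phi ->
    (forall y, sq_num A' y -> exists2 x, sq_num B x & sq_den A' (y - phi x)) ->
    same_cartan B A' phi ->
  forall z, z \in sp G -> z * e = z -> sq_den A' (phi z) -> z = 0.
Proof.
move=> hphi surj cartanE z Gz ze; apply: same_cartan_ker0 hphi surj cartanE _ _.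
- exact: block_num.
- exact: block_den.
- exact: block_mulv_closed.
- exact: block_identity.
exact/block_memv.
Qed.

Let quotient := block_image_quotient G N e.
Let phi : 'Hom(galg F gT, galg F (coset_of N)) := linfun (galg_map (coset N)).

Let nNG : (G \subset 'N(N))%g. Proof. exact: normal_norm. Qed.

Lemma block_quotient_morph : subquot_morph B quotient phi.
Proof.
have map_e x : x \in U -> galg_map (coset N) e * galg_map (coset N) x =
    galg_map (coset N) x /\ galg_map (coset N) x * galg_map (coset N) e =
    galg_map (coset N) x.
  by move=> /block_memv[Gx xe]; rewrite -!(galg_mapM _ nNG) // xe -eC // xe.
split=> [x Bx|x y|x ->|].
- by exists x => //; rewrite lfunE.
- move=> /block_num/block_memv[Gx _] /block_num/block_memv[Gy _].
  by rewrite !lfunE /= (galg_mapM _ nNG) //; apply: subrr.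
- exact: linear0.
exists e; first exact: block_identity.
split=> [|_ [x /block_num Ux <-]]; rewrite lfunE.
  by exists e => //; apply/block_num/block_memv.
by have [-> ->] := map_e x Ux; rewrite subrr.
Qed.

Lemma block_quotient_surj y : sq_num quotient y ->
  exists2 x, sq_num B x & sq_den quotient (y - phi x).
Proof. by move=> [x Bx <-]; exists x => //; rewrite lfunE; apply: subrr. Qed.

(** [e * gelt n - e] dies in [F[G / N]], so it is zero by injectivity. *)
Lemma same_cartan_quotient : same_cartan B quotient (galg_map (coset N)) ->
  forall n, n \in N -> e * gelt F n = e.
Proof.
rewrite (_ : galg_map (coset N) = phi); last by apply/funext=> x; rewrite lfunE.
move=> cartanE n Nn; apply/eqP; rewrite -subr_eq0; apply/eqP.
have Gn : gelt F n \in sp G.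
  by rewrite memv_gelt // (fintype.subsetP (normal_sub nsNG)).
apply: (block_same_cartan_ker0 block_quotient_morph block_quotient_surj cartanE).
- by rewrite memvB // galg_space_mulv_closed.
- by rewrite mulrBl ee -mulrA eC // mulrA ee.
rewrite linearB /= !lfunE /= (galg_mapM _ nNG) // galg_map_gelt.
by rewrite /= coset_id // mulr1; apply: subrr.
Qed.

Let RI := @rad_ideal F gT G N.

Lemma rad_ideal_memv z : RI z -> z \in sp G.
Proof.
move=> [n [a [x [Ga Jx ->]]]]; apply: memv_suml => i _.
apply: galg_space_mulv_closed; first exact/galg_spaceP.
by apply: (galg_spaceS (normal_sub nsNG)); case: (Jx i) => /galg_spaceP.
Qed.

Lemma rad_ideal0 : RI 0.
Proof. by exists 0%N, (fun=> 0), (fun=> 0); rewrite big_ord0; split=> [[]|[]|]. Qed.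

Lemma rad_idealM b z : b \in sp G -> RI z -> RI (b * z).
Proof.
move=> Gb [n [a [x [Ga Jx ->]]]]; exists n, (fun i => b * a i), x; split=> //.
  by move=> i; apply/galg_spaceP/galg_space_mulv_closed => //; apply/galg_spaceP.
by rewrite mulr_sumr; apply: eq_bigr => i _; rewrite mulrA.
Qed.

Lemma jacobson_rad_ideal x b : J x -> b \in sp G -> RI (b * x).
Proof.
move=> Jx Gb; exists 1%N, (fun=> b), (fun=> x); rewrite big_ord1.
by split=> // _; apply/galg_spaceP.
Qed.

Let mod_rad := block_image_mod_rad G N e.

Lemma mod_rad_num x : sq_num B x -> sq_num mod_rad x.
Proof.
by move=> Bx; exists x => //; exists 0; [apply: rad_ideal0 | rewrite addr0].
Qed.

Lemma mod_rad_identity : is_identity mod_rad e.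
Proof.
split=> [|_ [x /block_num/block_memv[Gx xe] [k RIk <-]]].
  exact/mod_rad_num/block_num/block_memv.
have Gk := rad_ideal_memv RIk.
have D : e * (x + k) - (x + k) = (e - 1) * k.
  by rewrite mulrDr -(eC Gx) xe opprD addrACA subrr add0r mulrBl mul1r.
split; first by rewrite D; apply: rad_idealM; rewrite ?memvB ?memv_galg1.
by rewrite eC ?memvD // D; apply: rad_idealM; rewrite ?memvB ?memv_galg1.
Qed.

Lemma block_mod_rad_morph : subquot_morph B mod_rad \1%VF.
Proof.
split=> [x /mod_rad_num|x y _ _|x ->|]; rewrite ?id_lfunE //.
- by rewrite subrr; apply: rad_ideal0.
- exact: rad_ideal0.
exists e; first exact: block_identity.
by rewrite id_lfunE; apply: mod_rad_identity.
Qed.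

Lemma block_mod_rad_surj y : sq_num mod_rad y ->
  exists2 x, sq_num B x & sq_den mod_rad (y - \1%VF x).
Proof.
by move=> [x Bx [k RIk <-]]; exists x; rewrite // id_lfunE addrAC subrr add0r.
Qed.

(** [x * e = e * x] lies in [F[G]J], the kernel of the surjection. *)
Lemma same_cartan_mod_rad : same_cartan B mod_rad id ->
  forall x, J x -> x * e = 0.
Proof.
move=> /same_cartan_idE cartanE x Jx.
have Gx : x \in sp G.
  by apply: (galg_spaceS (normal_sub nsNG)); case: Jx => /galg_spaceP.
apply: (block_same_cartan_ker0 block_mod_rad_morph block_mod_rad_surj cartanE).
- exact: galg_space_mulv_closed.
- by rewrite -mulrA ee.
by rewrite id_lfunE eC //; apply: jacobson_rad_ideal.
Qed.

(** Right multiplication by [e] kills [F[G]J] and fixes the block algebra, so it inverts the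
    surjection. *)
Lemma mod_rad_same_cartan : (forall x, J x -> x * e = 0) ->
  same_cartan B mod_rad id.
Proof.
move=> Je; have RIe k : RI k -> k * e = 0.
  move=> [n [a [x [_ Jx ->]]]]; rewrite mulr_suml big1 // => i _.
  by rewrite -mulrA Je ?mulr0.
have numP y : sq_num mod_rad y -> [/\ y \in sp G, sq_num B (y * e) & RI (y - y * e)].
  move=> [x /block_num Ux [k RIk <-]]; have [Gx xe] := proj1 (block_memv x) Ux.
  rewrite mulrDl xe RIe // addr0; split; last by rewrite addrAC subrr add0r.
    by apply: memvD => //; apply: rad_ideal_memv.
  exact/block_num.
apply/same_cartan_idE; apply: (@same_cartan_equiv _ _ _ _ _ _ (amulr e)).
- exact: block_mod_rad_morph.
- split=> [y /numP[_ By _]|y z /numP[Gy _ _] /numP[Gz _ _]|y RIy|].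
  + by rewrite lfunE.
  + by rewrite !lfunE /= -[y * e * _]mulrA (mulrA e) -eC // -!mulrA ee; apply: subrr.
  + by rewrite lfunE; apply: RIe.
  exists e; first exact: mod_rad_identity.
  by rewrite lfunE /= ee; apply: block_identity.
- move=> x /block_num/block_memv[_ xe].
  by rewrite id_lfunE lfunE /= xe; apply: subrr.
by move=> y /numP[_ _ RIy]; rewrite id_lfunE lfunE.
Qed.

End BlockImages.

Theorem corollary5p4 (F : fieldType) (p : nat) (gT : finGroupType)
    (G N : {group gT}) (e : galg F gT)
    (hp : p \in [pchar F]%R)
    (splitG : group_splitting_field F G)
    (splitN : group_splitting_field F N)
    (splitGN : group_splitting_field F (G / N)%G)
    (nsNG : (N <| G)%g)
    (he : block_idem G e) :
  (exists f : galg F gT,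
     [/\ block_idem N f, block_covers e f & has_defect p N f 0]) <->
  (same_cartan (block_subquot G e) (block_image_quotient G N e)
     (galg_map (coset N)) \/
   same_cartan (block_subquot G e) (block_image_mod_rad G N e) id).
Proof.
have [ce e0 _] := he; split=> [[f [[cf _ _] ef df]]|].
  right; apply: mod_rad_same_cartan => //.
  exact: (jacobson_mul_covering_block nsNG he cf ef df).
have [/galg_spaceP Ge ee Ze] := ce.
have eC x : x \in galg_space F G -> x * e = e * x by move/galg_spaceP/Ze.
have [f pf ef] := exists_covered_block N e0.
move=> cartanE; exists f; split; [exact: primitive_center_block | exact/eqP |].
case: cartanE => cartanE.
  have N0 := fixed_idem_card (normal_sub nsNG) Ge ee eC e0
    (same_cartan_quotient nsNG ce cartanE).
  have [Zf _ _ _] := pf; move: Zf; rewrite memv_cap => /andP[Nf /centvP fC].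
  (* Conjugation by [N] fixes [f], so the trace of [f] is [#|N|] times [f], and [#|N|] is invertible
     here. *)
  apply/defect_zeroP; exists (#|N|%:R^-1 *: f); first exact: memvZ.
  rewrite /conj_trace (eq_bigr (fun=> #|N|%:R^-1 *: f)).
    by rewrite sumr_const -scaler_nat scalerA mulfV // scale1r.
  move=> g Ng; rewrite -scalerAr -scalerAl -fC ?memv_gelt //.
  by rewrite -mulrA geltV mulr1.
have Je := same_cartan_mod_rad nsNG ce cartanE.
exact: (covered_block_defect_zero (normal_sub nsNG) Ge ee eC Je).
Qed.
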